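(* (a) Let $\mathcal{O}$ be the ideal cipher oracle. For every one-time oracle signature scheme (with perfect completeness) for messages $\{0,1\}^n$ using a total of $q\le n/4$ queries to $\mathcal{O}$, there is an adversary making $2^{(4-o(1))q}$ oracle queries that breaks the scheme with probability $1-o(1)$. (b) Let $\mathcal{O}$ be the random permutation oracle. For every one-time oracle signature scheme (with perfect completeness) for messages $\{0,1\}^n$ using a total of $q\le n/2$ queries to $\mathcal{O}$, there is an adversary making $2^{(2-o(1))q}$ oracle queries that breaks the scheme with probability $1-o(1)$. Here $o(1)$ denotes terms tending to $0$ as $q\to\infty$.
   Context: Random permutation oracle: for each length $m$, an independent uniformly random permutation $f$ of $\{0,1\}^m$; on query $x\in\{0,1\}^m$ it returns $f(x)$. Ideal cipher oracle with message length $m$: for every key $k\in\{0,1\}^*$ an independent uniformly random permutation $f_k$ of $\{0,1\}^m$; on query $(k,x,d)$ with $d\in\{\mathsf{F},\mathsf{B}\}$ it returns $f_k(x)$ if $d=\mathsf{F}$ and $f_k^{-1}(x)$ if $d=\mathsf{B}$. An oracle signature scheme with perfect completeness for $\mathcal{M}$ is a triple of oracle algorithms $(\mathsf{Gen},\mathsf{Sign},\mathsf{Ver})$ ($\mathsf{Gen}$ possibly probabilistic, outputting $(SK,VK)$) with $\mathsf{Ver}^{\mathcal{O}}(VK,\alpha,\mathsf{Sign}^{\mathcal{O}}(SK,\alpha))=1$ for every oracle, every positive-probability key pair and every $\alpha\in\mathcal{M}$. The total number of queries is counted over generating the keys, signing one message and verifying that signature. Breaking the one-time scheme: the adversary receives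 $VK$, chooses a message $\alpha$ independently of $VK$, receives $\mathsf{Sign}^{\mathcal{O}}(SK,\alpha)$, queries the oracle, and outputs $(\alpha^*,\sigma^* )$ with $\alpha^*\ne\alpha$ and $\mathsf{Ver}^{\mathcal{O}}(VK,\alpha^*,\sigma^* )=1$; probabilities are over the oracle and all coins. *)

(* Defs.v *)
From HB Require Import structures.
From mathcomp Require Import all_boot all_order all_algebra all_fingroup.
From mathcomp Require Import all_classical all_reals all_analysis.

Set Implicit Arguments.
Unset Strict Implicit.
Unset Printing Implicit Defensive.

Import Order.TTheory GRing.Theory Num.Theory.
Import numFieldNormedType.Exports.

Local Open Scope classical_set_scope.
Local Open Scope ring_scope.

Notation bits := (seq bool).
Notation block m := (m.-tuple bool).

(* An oracle whose randomness is a family of permutations of finite sets: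
   [respond f x] is its answer to the query [x] when that family is [f]. *)
Record perm_oracle := PermOracle {
  perm_index : eqType;
  perm_dom : perm_index -> finType;
  query : Type;
  answer : query -> Type;
  respond : (forall i : perm_index, {perm perm_dom i}) ->
    forall x : query, answer x
}.

Definition perm_family (O : perm_oracle) : Type :=
  forall i : perm_index O, {perm perm_dom i}.

(* One permutation for each length; a query is a string tagged by its length. *)
Definition random_permutation : perm_oracle :=
  @PermOracle nat (fun m : nat => block m)
    {m : nat & block m} (fun x => block (tag x))
    (fun f x => f (tag x) (tagged x)).

Variant direction := Forward | Backward.

Definition ideal_cipher (m : nat) : perm_oracle :=
  @PermOracle bits (fun _ => block m)
    (bits * block m * direction)%type (fun _ => block m)
    (fun f x => let: (k, y, d) := x in
       match d with
       | Forward => f k y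
       | Backward => (f k)^-1%g y
       end).

(* Deterministic oracle algorithms with output in X, as trees of adaptive
   queries; probabilistic ones are families of these indexed by a random seed. *)
Inductive oracle_alg (O : perm_oracle) (X : Type) : Type :=
| Return of X
| Query (x : query O) of (answer x -> oracle_alg O X).

Fixpoint run (O : perm_oracle) (X : Type) (f : perm_family O)
    (a : oracle_alg O X) : X :=
  match a with
  | Return y => y
  | Query x k => run f (k (respond f x))
  end.

Fixpoint num_queries (O : perm_oracle) (X : Type) (f : perm_family O)
    (a : oracle_alg O X) : nat :=
  match a with
  | Return _ => 0
  | Query x k => (num_queries f (k (respond f x))).+1
  end.

(* The seed of a probabilistic algorithm has an arbitrary distribution on nat.
   This covers every source of coins: each query to the two oracles above has
   finitely many possible answers, so there are only countably many trees with
   strings as outputs, and arbitrary coins induce a discrete distribution on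
   them. *)
Record signature_scheme (R : realType) (O : perm_oracle) (n : nat) :=
  SignatureScheme {
    gen_coins : probability nat R;
    gen : nat -> oracle_alg O (bits * bits);  (* (SK, VK) *)
    sign : bits -> block n -> oracle_alg O bits;
    verify : bits -> block n -> bits -> oracle_alg O bool
  }.

Definition perfectly_complete (R : realType) (O : perm_oracle) (n : nat)
    (S : signature_scheme R O n) : Prop :=
  forall (f : perm_family O) (SK VK : bits),
    (0 < gen_coins S [set s | run f (gen S s) = (SK, VK)])%E ->
  forall alpha : block n,
    run f (verify S VK alpha (run f (sign S SK alpha))) = true.

Definition total_queries_le (R : realType) (O : perm_oracle) (n : nat)
    (S : signature_scheme R O n) (q : nat) : Prop :=
  forall (f : perm_family O) (s : nat), (0 < gen_coins S [set s])%E ->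
  forall alpha : block n,
    let: (SK, VK) := run f (gen S s) in
    let sigma := run f (sign S SK alpha) in
    (num_queries f (gen S s) + num_queries f (sign S SK alpha)
       + num_queries f (verify S VK alpha sigma) <= q)%N.

(* [chosen r] is the message whose signature is requested; it depends on the
   adversary's coins only, hence is independent of VK. *)
Record adversary (R : realType) (O : perm_oracle) (n : nat) := Adversary {
  adv_coins : probability nat R;
  chosen : nat -> block n;
  (* from the coins, VK and the signature of the chosen message, a forgery *)
  forge : nat -> bits -> bits -> oracle_alg O (block n * bits)
}.

Definition adversary_queries_le (R : realType) (O : perm_oracle) (n : nat)
    (A : adversary R O n) (b : R) : Prop :=
  forall (f : perm_family O) (r : nat) (VK sigma : bits),
    (num_queries f (forge A r VK sigma))%:R <= b.

Definition breaks (R : realType) (O : perm_oracle) (n : nat)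
    (S : signature_scheme R O n) (A : adversary R O n)
    (f : perm_family O) (s r : nat) : Prop :=
  let: (SK, VK) := run f (gen S s) in
  let sigma := run f (sign S SK (chosen A r)) in
  let: (alpha', sigma') := run f (forge A r VK sigma) in
  alpha' <> chosen A r /\ run f (verify S VK alpha' sigma') = true.

(* F is a family of mutually independent, uniformly distributed random
   permutations.  As each F i has finitely many values, measurability of
   its fibres is measurability of F i. *)
Definition random_perm_family (R : realType) (O : perm_oracle)
    (d : measure_display) (Omega : measurableType d) (P : probability Omega R)
    (F : Omega -> perm_family O) : Prop :=
  [/\ forall (i : perm_index O) (p : {perm perm_dom i}),
        measurable [set w | F w i = p],
      forall (i : perm_index O) (p : {perm perm_dom i}),
        P [set w | F w i = p] = ((#|{perm perm_dom i}|%:R)^-1)%:E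
    & forall (J : seq (perm_index O))
             (B : forall i : perm_index O, {set {perm perm_dom i}}),
        uniq J ->
        P (\bigcap_(i in [set` J]) [set w | F w i \in B i])
        = (\prod_(i <- J) P [set w | F w i \in B i])%E].

(* The product measure makes the oracle, the coins of Gen and the coins of the
   adversary independent. *)
Definition break_prob (R : realType) (O : perm_oracle) (n : nat)
    (d : measure_display) (Omega : measurableType d) (P : probability Omega R)
    (F : Omega -> perm_family O)
    (S : signature_scheme R O n) (A : adversary R O n) : \bar R :=
  ((P \x gen_coins S) \x adv_coins A)%E
    [set w | breaks S A (F w.1.1) w.1.2 w.2].

(* Main.v *)
Require Import Defs.
From mathcomp Require Import all_boot all_order all_algebra all_fingroup.
From mathcomp Require Import boolp.
From mathcomp Require Import ring lra zify.

(* In a world (an oracle together with a key generation seed) let P(m) be the set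
   of queries made while generating the keys and signing m, and V(m) the set of
   queries made while verifying that signature.  By the set-pair inequality there
   are at most 2^q messages m for which every other V(m') meets P(m) outside V(m),
   so among q 2^q messages some fixed m0 is rarely of this kind.  The adversary asks
   for the signature of m0 and then keeps asking each query which, conditionally on
   its view, occurs with probability more than q^-2 in the complete run on all
   q 2^q messages; the expected number of its queries still unknown drops each time,
   so 2^q poly(q) queries are enough.  After that two independent worlds
   sampled from the posterior rarely share unknown queries.  Hence the adversary can
   choose one world from the posterior, override the real oracle by its P(m0), and
   run the signing and verification algorithms on all the messages: up to a small
   statistical distance this run looks like a run in a posterior world, so it
   produces some m <> m0 with V(m) meeting P(m0) in known queries only.  On these
   the overridden oracle agrees with the real one, which therefore accepts.

   Permutations of domains of size more than about 2^q poly(q) have nearly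
   independent fresh answers; the smaller ones are read off completely whenever
   they are touched, for a total of 2^(2q) poly(q) queries. *)

Set Implicit Arguments.
Unset Strict Implicit.
Unset Printing Implicit Defensive.

Import Order.TTheory GRing.Theory Num.Theory.
Local Open Scope ring_scope.

(** * Query trees *)

Section QueryTrees.
Variables (U : eqType) (A : U -> finType).

(** Queries are abstract here and each has a finite type of answers, so that a single query may also
    return a whole permutation. *)
Inductive tree (X : Type) := Ret of X | Ask (u : U) of (A u -> tree X).

Implicit Type h : forall u, A u.

Fixpoint outcome X h (t : tree X) : X :=
  match t with Ret x => x | Ask u k => outcome h (k (h u)) end.

Fixpoint trace X h (t : tree X) : seq U :=
  match t with Ret _ => [::] | Ask u k => u :: trace h (k (h u)) end.

Fixpoint bind X Y (t : tree X) (f : X -> tree Y) : tree Y :=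
  match t with Ret x => f x | Ask u k => Ask (fun a => bind (k a) f) end.

(** The log makes the queries part of the output, where whoever simulates the run can inspect
    them. *)
Fixpoint logged X (t : tree X) : tree (X * seq U) :=
  match t with
  | Ret x => Ret (x, [::])
  | Ask u k => Ask (fun a => bind (logged (k a)) (fun r => Ret (r.1, u :: r.2)))
  end.

Fixpoint collect X Y (f : X -> tree Y) (s : seq X) : tree (seq Y) :=
  match s with
  | [::] => Ret [::]
  | x :: s' => bind (f x) (fun y => bind (collect f s') (fun r => Ret (y :: r)))
  end.

Fixpoint queries_in (ok : pred U) X (t : tree X) : Prop :=
  match t with
  | Ret _ => True
  | Ask u k => ok u /\ forall a, queries_in ok (k a)
  end.

Lemma outcome_bind X Y h (t : tree X) (f : X -> tree Y) :
  outcome h (bind t f) = outcome h (f (outcome h t)).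
Proof. by elim: t => //= u k IH; rewrite IH. Qed.

Lemma trace_bind X Y h (t : tree X) (f : X -> tree Y) :
  trace h (bind t f) = trace h t ++ trace h (f (outcome h t)).
Proof. by elim: t => //= u k IH; rewrite IH. Qed.

Lemma outcome_logged X h (t : tree X) : outcome h (logged t) = (outcome h t, trace h t).
Proof. by elim: t => //= u k IH; rewrite outcome_bind IH. Qed.

Lemma trace_logged X h (t : tree X) : trace h (logged t) = trace h t.
Proof. by elim: t => //= u k IH; rewrite trace_bind IH /= cats0. Qed.

Lemma outcome_collect X Y h (f : X -> tree Y) s :
  outcome h (collect f s) = [seq outcome h (f x) | x <- s].
Proof. by elim: s => //= x s IH; rewrite !outcome_bind IH. Qed.

Lemma trace_collect X Y h (f : X -> tree Y) s :
  trace h (collect f s) = flatten [seq trace h (f x) | x <- s].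
Proof. by elim: s => //= x s IH; rewrite !trace_bind IH /= cats0. Qed.

Lemma outcome_trace_eq X h h' (t : tree X) :
  {in trace h t, forall u, h u = h' u} ->
  outcome h' t = outcome h t /\ trace h' t = trace h t.
Proof.
elim: t => //= u k IH hh'.
have e : h u = h' u by apply: hh'; rewrite inE eqxx.
rewrite -e; have [|-> ->] // := IH (h u).
by move=> v hv; apply: hh'; rewrite inE hv orbT.
Qed.

Lemma queries_in_bind ok X Y (t : tree X) (f : X -> tree Y) :
  queries_in ok t -> (forall x, queries_in ok (f x)) -> queries_in ok (bind t f).
Proof. by move=> + hf; elim: t => //= u k IH [-> hk]; split => // a; apply: IH. Qed.

Lemma queries_in_bind_inv ok X Y h (t : tree X) (f : X -> tree Y) :
  queries_in ok (bind t f) -> queries_in ok t /\ queries_in ok (f (outcome h t)).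
Proof.
elim: t => //= u k IH [oku hk]; split; last by case: (IH _ (hk (h u))).
by split=> // a; case: (IH _ (hk a)).
Qed.

Lemma queries_in_logged_inv ok X (t : tree X) :
  queries_in ok (logged t) -> queries_in ok t.
Proof.
elim: t => //= u k IH [oku hk]; split=> // a; apply: IH.
move: (hk a); elim: (logged (k a)) => //= v k' IH' [okv hk']; split=> // b.
exact: IH'.
Qed.

Lemma queries_in_collect_inv ok (X : eqType) Y h (f : X -> tree Y) s :
  queries_in ok (collect f s) -> {in s, forall x, queries_in ok (f x)}.
Proof.
elim: s => //= x s IH /(queries_in_bind_inv h)[okx].
move=> /(queries_in_bind_inv h)[oks _] y.
by rewrite inE => /orP[/eqP -> //|]; apply: IH.
Qed.

Lemma queries_in_logged ok X (t : tree X) :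
  queries_in ok t -> queries_in ok (logged t).
Proof.
by elim: t => //= u k IH [-> hk]; split => // a; apply: queries_in_bind => //; apply: IH.
Qed.

Lemma queries_in_collect ok X Y (f : X -> tree Y) s :
  (forall x, queries_in ok (f x)) -> queries_in ok (collect f s).
Proof.
move=> hf; elim: s => //= x s IH; apply: queries_in_bind => // y.
exact: queries_in_bind.
Qed.

(** Queries on every branch, not only on one run. The list is finite because answers are, and it
    later bounds the set of permutations that matter. *)
Fixpoint queries_of X (t : tree X) : seq U :=
  match t with
  | Ret _ => [::]
  | Ask u k => u :: flatten [seq queries_of (k a) | a <- enum (A u)]
  end.

Lemma queries_in_sub (P ok : pred U) X (t : tree X) :
  {in queries_of t, forall u, P u -> ok u} -> queries_in P t -> queries_in ok t.
Proof.
elim: t => //= u k IH h [Pu hk]; split; first by apply: h => //; rewrite inE eqxx.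
move=> a; apply: IH => // v vk; apply: h; rewrite inE; apply/orP; right.
by apply/flatten_mapP; exists a; rewrite ?mem_enum.
Qed.

Lemma trace_queries_in ok X h (t : tree X) : queries_in ok t -> all ok (trace h t).
Proof. by elim: t => //= u k IH [-> hk] /=; apply: IH. Qed.

End QueryTrees.

(** * The set-pair inequality *)

Section SetPairs.

(* Colour the elements red and blue at random.  The events "the first set of the
   pair is red and the second is blue" are disjoint for distinct pairs, and each
   has probability at least 2^-q (Bollobas' set-pair inequality). *)
Lemma set_pair_bound (C : choiceType) (I : finType) (q : nat) (a b : I -> seq C) :
  (forall i, size (a i) + size (b i) <= q)%N ->
  (#|[set i | [forall (j | j != i),
        has (fun c => (c \in a i) && (c \notin b i)) (b j)]]| <= 2 ^ q)%N.
Proof.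
move=> hq; set Bad := [set i | _].
pose l := flatten [seq a i ++ b i | i <- enum I].
pose Z : finType := seq_sub l.
pose a' i := [set z : Z | (val z \in a i) && (val z \notin b i)].
pose b' i := [set z : Z | val z \in b i].
have card_le (s : seq C) (Q : {set Z}) : {in Q, forall z, val z \in s} ->
    (#|Q| <= size s)%N.
  move=> hs; rewrite cardE -(size_map val); apply: uniq_leq_size.
    by rewrite map_inj_uniq ?enum_uniq //; exact: val_inj.
  by move=> c /mapP[z]; rewrite mem_enum => /hs zs ->.
(* A colouring is given by its red set; [e i] collects those in which [a' i] is red and [b' i] is
   blue. *)
pose e i := [set a' i :|: X | X in powerset (~: (a' i :|: b' i))].
have card_e i : (2 ^ #|Z| <= #|e i| * 2 ^ q)%N.
  rewrite card_in_imset; last first.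
    move=> X Y; rewrite !powersetE => hX hY /setP eXY; apply/setP => z.
    have := eXY z; rewrite !inE.
    case za : (val z \in a i); case zb : (val z \in b i) => //=;
      have := subsetP hX z; have := subsetP hY z; rewrite !inE za zb /=;
      case: (z \in X) => //; case: (z \in Y) => //;
      by [move=> /(_ isT)| move=> _ /(_ isT)].
  rewrite card_powerset -expnD leq_exp2l //.
  rewrite -(cardsC (a' i :|: b' i)) addnC leq_add2l.
  apply: leq_trans (leq_trans (leq_card_setU _ _) _) (hq i).
  by apply: leq_add; apply: card_le => z; rewrite inE // => /andP[].
have disj i j X : i \in Bad -> j \in Bad -> X \in e i -> X \in e j -> i = j.
  move=> iB jB /imsetP[X1 hX1 eX1] /imsetP[X2 hX2 eX2].
  apply/eqP; apply: contraT => nij.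
  move: iB; rewrite inE => /forallP/(_ j); rewrite eq_sym nij /=.
  move=> /hasP[c cb /andP[ca ncb]].
  (* The element [c] is forced to be red by [i] and blue by [j]. *)
  have cl : c \in l.
    by apply/flatten_mapP; exists i; rewrite ?mem_enum // mem_cat ca.
  pose z : Z := SeqSub cl.
  have : z \in X by rewrite eX1 !inE /= ca ncb.
  rewrite eX2 !inE /= cb andbF /= => zX2.
  by move: hX2; rewrite powersetE => /subsetP/(_ z zX2); rewrite !inE /= cb orbT.
have tot : (\sum_(i in Bad) #|e i| <= 2 ^ #|Z|)%N.
  have <- : #|[set: {set Z}]| = (2 ^ #|Z|)%N.
    by rewrite -(powersetT Z) card_powerset cardsT.
  under eq_bigr => i _ do rewrite -sum1_card.
  rewrite (exchange_big_dep predT) //= cardsT -sum1_card; apply: leq_sum => X _.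
  rewrite sum1dep_card; apply/card_le1_eqP => i j.
  rewrite in_set => /andP[iB iX]. rewrite in_set => /andP[jB jX]. exact: (disj j i X jB iB jX iX).
have Z0 : (0 < 2 ^ #|Z|)%N by rewrite expn_gt0.
rewrite -(leq_pmul2r Z0) -sum_nat_const.
apply: (@leq_trans (\sum_(i in Bad) #|e i| * 2 ^ q)%N).
  by apply: leq_sum => i _; apply: card_e.
by rewrite -big_distrl /= mulnC leq_mul2l tot orbT.
Qed.

End SetPairs.

(** * The attack on an oracle with finitely many worlds *)

Section Averages.
Variable R : realFieldType.

Definition average (T : finType) (X : {set T}) (phi : T -> R) : R :=
  (\sum_(g in X) phi g) / #|X|%:R.

Definition frequency (T : finType) (B : eqType) (X : {set T}) (f : T -> B)
  (b : B) : R := #|[set g in X | f g == b]|%:R / #|X|%:R.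

(** After exchanging the sums, [h] receives a share [1 / #|cls h|] from each member of its own
    class. *)
Lemma sum_average_class (T : finType) (Y : {set T}) (cls : T -> {set T})
    (psi : T -> R) :
  (forall g, g \in cls g) ->
  (forall g h, g \in Y -> h \in cls g -> h \in Y /\ cls h = cls g) ->
  \sum_(g in Y) average (cls g) psi = \sum_(h in Y) psi h.
Proof.
move=> cls_refl cls_eq.
under eq_bigr => g _ do rewrite /average mulr_suml.
rewrite (exchange_big_dep (mem Y)) /=; last by move=> g h gY /(cls_eq _ _ gY)[].
apply: eq_bigr => h hY.
have step g : (g \in Y) && (h \in cls g) = (g \in cls h).
  apply/andP/idP => [[gY hg]|gh]; first by have [_ ->] := cls_eq _ _ gY hg.
  by have [gY ->] := cls_eq _ _ hY gh.
rewrite (eq_bigl _ _ step) (eq_bigr (fun=> psi h / #|cls h|%:R)); last first.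
  by move=> g gh; have [_ ->] := cls_eq _ _ hY gh.
rewrite sumr_const -[LHS]mulr_natr divfK // pnatr_eq0 -lt0n.
by apply/card_gt0P; exists h.
Qed.

(** The values of [f] need not form a finite type, as with the views below, so the sum is
    partitioned by the level sets of [f], which do. *)
Lemma sum_le0_fibers (T : finType) (B : eqType) (f : T -> B) (F : T -> R) :
  (forall b, \sum_(x | f x == b) F x <= 0) -> \sum_x F x <= 0.
Proof.
move=> hF; rewrite (partition_big (fun x => [set y | f y == f x]) predT) //=.
apply: sumr_le0 => Q _.
have [[x xQ]|nQ] := pselect (exists x, [set y | f y == f x] == Q); last first.
  by rewrite big1 // => x xQ; case: nQ; exists x.
rewrite (eq_bigl (fun y => f y == f x)) // => y /=.
apply/eqP/eqP => [|->]; last exact/eqP.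
by rewrite -(eqP xQ) => /setP/(_ x); rewrite !inE eqxx => /eqP.
Qed.

Lemma average_eq (T : finType) (Y : {set T}) (phi psi : T -> R) :
  (forall g, g \in Y -> phi g = psi g) -> average Y phi = average Y psi.
Proof. by move=> h; rewrite /average (eq_bigr psi). Qed.

Lemma average_le (T : finType) (Y : {set T}) (phi psi : T -> R) :
  (forall g, g \in Y -> phi g <= psi g) -> average Y phi <= average Y psi.
Proof. by move=> h; rewrite /average ler_wpM2r ?invr_ge0 // ler_sum. Qed.

Lemma sum_fiber (T B : finType) (Y : {set T}) (f : T -> B) (phi : T -> R) :
  \sum_(g in Y) phi g = \sum_b \sum_(g in [set g in Y | f g == b]) phi g.
Proof.
rewrite (partition_big f predT) //=; apply: eq_bigr => b _.
by apply: eq_bigl => g; rewrite inE.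
Qed.

(** One round of a coupling: the statistical distance of the two answers is paid once, and the loss
    [c] is averaged over the answers, whose frequencies in [X1] sum to 1. *)
Lemma compare_step (T B : finType) (X1 X2 : {set T}) (f : T -> B) (phi psi : T -> R) (c kappa : R) :
  (forall g, 0 <= phi g <= 1) -> (forall g, 0 <= psi g <= 1) -> 0 <= c ->
  X1 != finset.set0 ->
  (forall b, [set g in X1 | f g == b] != finset.set0 -> [set g in X2 | f g == b] != finset.set0 ->
     average [set g in X1 | f g == b] phi <= average [set g in X2 | f g == b] psi + c) ->
  \sum_b Num.max 0 (frequency X1 f b - frequency X2 f b) <= kappa ->
  average X1 phi <= average X2 psi + (kappa + c).
Proof.
move=> phi01 psi01 c0 X10 hb hk.
have n1 : 0 < #|X1|%:R :> R by rewrite ltr0n card_gt0.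
have hc : c = \sum_b frequency X1 f b * c.
  rewrite -mulr_suml /frequency -mulr_suml.
  have -> : \sum_b #|[set g in X1 | f g == b]|%:R = #|X1|%:R :> R.
    rewrite -sum1_card natr_sum (sum_fiber _ f); apply: eq_bigr => b _.
    by rewrite -natr_sum sum1_card.
  by rewrite divff ?mul1r // gt_eqF.
apply: (@le_trans _ _ (average X2 psi +
  (\sum_b Num.max 0 (frequency X1 f b - frequency X2 f b) + c))); last first.
  by rewrite lerD2l lerD2r.
rewrite [in X in _ <= X]hc -big_split /= /average (sum_fiber X1 f) (sum_fiber X2 f).
rewrite !mulr_suml -big_split /=; apply: ler_sum => b _.
set S1 := [set g in X1 | _]; set S2 := [set g in X2 | _].
rewrite /frequency -/S1 -/S2.
have mx0 x : 0 <= Num.max 0 x :> R by rewrite le_max lexx.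
have mx x : x <= Num.max 0 x :> R by rewrite le_max lexx orbT.
have s2 : 0 <= \sum_(g in S2) psi g by apply: sumr_ge0 => g _; case/andP: (psi01 g).
have i2 : 0 <= #|X2|%:R^-1 :> R by rewrite invr_ge0.
have i1 : 0 <= #|X1|%:R^-1 :> R by rewrite invr_ge0.
have [S10|S10] := eqVneq S1 finset.set0.
  rewrite S10 big_set0 mul0r cards0 mul0r mul0r addr0.
  by rewrite addr_ge0 // mulr_ge0.
have s1 : \sum_(g in S1) phi g <= #|S1|%:R.
  rewrite -sum1_card natr_sum; apply: ler_sum => g _; by case/andP: (phi01 g).
(* An answer impossible in [X2] has frequency 0 there, so the distance term pays for all of it. *)
have [S20|S20] := eqVneq S2 finset.set0.
  rewrite S20 big_set0 mul0r cards0 mul0r subr0 add0r.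
  apply: le_trans (_ : #|S1|%:R / #|X1|%:R <= _); first by rewrite ler_wpM2r.
  by rewrite (le_trans (mx _)) // lerDl mulr_ge0 // divr_ge0.
have := hb b S10 S20; rewrite /average -/S1 -/S2.
set r := _ / #|S2|%:R; set a := \sum_(g in S1) _ => hr.
have p1 : 0 < #|S1|%:R :> R by rewrite ltr0n card_gt0.
have p2 : 0 < #|S2|%:R :> R by rewrite ltr0n card_gt0.
have e2 : \sum_(g in S2) psi g = r * #|S2|%:R by rewrite /r mulfVK // gt_eqF.
have r01 : 0 <= r <= 1.
  rewrite /r divr_ge0 //= ler_pdivrMr // mul1r -sum1_card natr_sum.
  by apply: ler_sum => g _; case/andP: (psi01 g).
move: hr; rewrite ler_pdivrMr // => hr; rewrite e2.
set m := Num.max _ _.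
apply: le_trans (_ : (r + c) * #|S1|%:R / #|X1|%:R <= _); first by rewrite ler_wpM2r.
have hm : r * (#|S1|%:R / #|X1|%:R - #|S2|%:R / #|X2|%:R) <= m.
  apply: le_trans (_ : r * m <= _); first by rewrite ler_wpM2l ?mx //; case/andP: r01.
  by rewrite -[leRHS]mul1r ler_wpM2r ?mx0 //; case/andP: r01.
rewrite -subr_ge0; apply: le_trans (_ : m - r * (#|S1|%:R / #|X1|%:R - #|S2|%:R / #|X2|%:R) <= _).
  by rewrite subr_ge0.
by rewrite le_eqVlt; apply/orP; left; apply/eqP; ring.
Qed.

End Averages.

Section Attack.
Variables (R : realFieldType) (U : eqType) (A : U -> finType) (W : finType).
Variables (ans : W -> forall u, A u) (C : choiceType) (cell : W -> U -> C).

(* Different queries (such as a forward and a backward one) can reveal the same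
   part of the oracle; [cell w u] is the part that [u] reveals when the oracle is [w]. *)
Hypothesis cell_agree : forall w1 w2 u v, ans w1 v = ans w2 v ->
  (cell w1 u == cell w1 v) = (cell w2 u == cell w2 v).
Hypothesis cell_ans : forall w1 w2 u v,
  cell w1 u = cell w1 v -> ans w1 v = ans w2 v -> ans w1 u = ans w2 u.
(** The bound 2 stands for the two directions in which one value of a permutation can be asked. *)
Hypothesis cell_two : forall w v, exists2 l : seq U, (size l <= 2)%N &
  forall u, cell w u = cell w v -> u \in l.

(** The answer to [u] is then determined by the answers to [K], even if [u] itself is not in [K];
    see [covered_ans]. *)
Definition covered w (K : seq U) u := cell w u \in [seq cell w v | v <- K].
Definition agree w1 w2 (K : seq U) := all (fun v => ans w1 v == ans w2 v) K.
Definition consistent w K : {set W} := [set g | agree w g K].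

Lemma agree_refl w K : agree w w K.
Proof. by apply/allP. Qed.

Lemma agree_sym w1 w2 K : agree w1 w2 K = agree w2 w1 K.
Proof. by apply: eq_all => v; rewrite eq_sym. Qed.

Lemma agree_trans w1 w2 w3 K : agree w1 w2 K -> agree w2 w3 K -> agree w1 w3 K.
Proof.
move=> /allP h1 /allP h2; apply/allP => v vK.
by rewrite (eqP (h1 v vK)) (eqP (h2 v vK)).
Qed.

Lemma agree_cat w1 w2 K1 K2 :
  agree w1 w2 (K1 ++ K2) = agree w1 w2 K1 && agree w1 w2 K2.
Proof. exact: all_cat. Qed.

Lemma covered_cat w K1 K2 u :
  covered w (K1 ++ K2) u = covered w K1 u || covered w K2 u.
Proof. by rewrite /covered map_cat mem_cat. Qed.

Lemma covered_mem w K u : u \in K -> covered w K u.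
Proof. exact: map_f. Qed.

Lemma covered_agree w1 w2 K u : agree w1 w2 K -> covered w1 K u = covered w2 K u.
Proof.
move=> /allP hK; apply/mapP/mapP => -[v vK /eqP e]; exists v => //; apply/eqP.
  by rewrite -(@cell_agree w1) //; exact/eqP/hK.
by rewrite (@cell_agree _ w2) //; exact/eqP/hK.
Qed.

Lemma covered_ans w1 w2 K u : agree w1 w2 K -> covered w1 K u -> ans w1 u = ans w2 u.
Proof.
move=> /allP hK /mapP[v vK e]; apply: (cell_ans e); exact/eqP/hK.
Qed.

Lemma consistent_refl w K : w \in consistent w K.
Proof. by rewrite inE agree_refl. Qed.

Lemma consistent_eq w1 w2 K : agree w1 w2 K -> consistent w1 K = consistent w2 K.
Proof.
move=> h; apply/setP => g; rewrite !inE; apply/idP/idP; apply: agree_trans => //.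
by rewrite agree_sym.
Qed.

Lemma consistent_cons w u K g : g \in consistent w K -> 
  consistent g (u :: K) = [set h in consistent w K | ans h u == ans g u].
Proof.
rewrite inE => wg; apply/setP => h; rewrite !inE /agree /= andbC eq_sym.
congr (_ && _); rewrite -/(agree g h K) -/(agree w h K).
apply/idP/idP; apply: agree_trans => //; by rewrite agree_sym.
Qed.

Lemma agree_outcome X w1 w2 (t : tree A X) K : agree w1 w2 K ->
  {subset trace (ans w1) t <= K} ->
  outcome (ans w2) t = outcome (ans w1) t /\ trace (ans w2) t = trace (ans w1) t.
Proof. by move=> /allP hK sub; apply: outcome_trace_eq => u /sub/hK/eqP. Qed.

Variables (ok : pred U) (q queries : nat) (kappa : R).

Hypothesis kappa_ge0 : 0 <= kappa.
(** The distributional property of the oracle on which the attack rests: [P1] and [P2] are the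
    private queries of two worlds that share the knowledge [K], and they hardly influence an answer
    that is new to both. *)
Hypothesis answers_close : forall w1 w2 K P1 P2 u, agree w1 w2 K ->
  (size K <= queries)%N -> (size P1 <= q)%N -> (size P2 <= q)%N ->
  ok u -> all ok K -> all ok P1 -> all ok P2 ->
  ~~ covered w1 (K ++ P1) u -> ~~ covered w2 (K ++ P2) u ->
  \sum_a Num.max 0 (frequency R (consistent w1 (K ++ P1)) (fun g => ans g u) a
                    - frequency R (consistent w2 (K ++ P2)) (fun g => ans g u) a)
  <= kappa.

(* The cut-off [d] is needed because the overridden oracle may be impossible (the
   answers may collide), so that no assumption bounds the queries of [t] on it. *)
Fixpoint simulate (w : W) (K : seq U) X (t : tree A X) (d : nat) : tree A (option X) :=
  match t with
  | Ret x => Ret A (Some x)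
  | Ask u k =>
      if covered w K u then simulate w K (k (ans w u)) d
      else if d is d'.+1 then Ask (fun a => simulate w K (k a) d') else Ret A None
  end.

Definition override w K (h : forall u, A u) : forall u, A u :=
  fun u => if covered w K u then ans w u else h u.

Lemma simulate_outcome w K X (t : tree A X) d h x :
  outcome h (simulate w K t d) = Some x -> outcome (override w K h) t = x.
Proof.
elim: t d => [y|u k IH] d /=; first by case.
rewrite /override; case: ifP => _; first exact: IH.
by case: d => //= d; apply: IH.
Qed.

Lemma simulate_size w K X (t : tree A X) d h : (size (trace h (simulate w K t d)) <= d)%N.
Proof.
elim: t d => [y|u k IH] d //=; case: ifP => _; first exact: IH.
by case: d => //= d; apply: IH.
Qed.

Lemma simulate_ok w K X (t : tree A X) d : queries_in ok t -> queries_in ok (simulate w K t d).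
Proof.
elim: t d => [y|u k IH] d //= [oku hk]; case: ifP => _; first exact: IH.
by case: d => //= d; split => // a; apply: IH.
Qed.

(** * A genuine run against a run with planted answers *)

Section Compare.
Variables (X : Type) (w0 f0 : W) (K P1 P2 : seq U) (good : X -> bool).
Hypotheses (okK : all ok K) (okP1 : all ok P1) (okP2 : all ok P2).
Hypotheses (sP1 : (size P1 <= q)%N) (sP2 : (size P2 <= q)%N).

(** A touched query is one that the second posterior fixes through [P2] while the common knowledge
    [K] does not; runs that make one are given up. *)
Definition untouched g (t : tree A X) :=
  all (fun u => covered f0 P2 u ==> covered g K u) (trace (ans g) t).

Let success g (t : tree A X) : R := (good (outcome (ans g) t) && untouched g t)%:R.
Definition option_good (o : option X) : bool := if o is Some x then good x else false.
Let win g (t : tree A X) d : R :=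
  (option_good (outcome (ans g) (simulate w0 (K ++ P1) t d)))%:R.

Let Xset1 w tau := consistent w ((tau ++ K) ++ P1).
Let Xset2 w tau := consistent w ((tau ++ K) ++ P2).

Lemma success01 g t : 0 <= success g t <= 1.
Proof. by rewrite /success ler0n lern1 leq_b1. Qed.

Lemma win01 g t d : 0 <= win g t d <= 1.
Proof. by rewrite /win ler0n lern1 leq_b1. Qed.

(* Run the two sides in parallel.  A query that is new to both posteriors receives
   answers of nearly the same distribution, and a query known only to the second one
   is excluded by [untouched]. *)
Lemma simulate_compare d (t : tree A X) tau w1 w2 :
  queries_in ok t -> all ok tau -> (size tau + size K + d <= queries)%N ->
  agree w0 w1 (K ++ P1) -> agree w1 w2 (tau ++ K) -> agree f0 w2 P2 ->
  (forall g, g \in Xset1 w1 tau -> (size (trace (ans g) t) <= d)%N) ->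
  average (Xset1 w1 tau) (fun g => success g t)
  <= average (Xset2 w2 tau) (fun g => win g t d) + d%:R * kappa.
Proof.
have avg_const (Y : {set W}) (b : R) : Y != finset.set0 -> average Y (fun=> b) = b.
  move=> Y0; rewrite /average sumr_const -[X in X / _]mulr_natr mulfK // pnatr_eq0.
  by rewrite cards_eq0.
have ne w L : consistent w L != finset.set0.
  by apply/set0Pn; exists w; apply: consistent_refl.
elim: t d tau w1 w2 => [x|u k IH] d tau w1 w2 /=.
  move=> _ _ _ _ _ _ _.
  rewrite (average_eq (psi := fun=> (good x)%:R)); last first.
    by move=> g _; rewrite /success /= andbT.
  rewrite (avg_const _ _ (ne _ _)) [X in _ <= X + _]avg_const ?lerDl ?mulr_ge0 //; exact: ne.
move=> [oku okk] oktau sz a01 a12 a02 hd.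
have in1 g : g \in Xset1 w1 tau -> [/\ agree w1 g (K ++ P1), agree w1 g (tau ++ K) &
     agree w1 g ((tau ++ K) ++ P1)].
  rewrite inE => h; rewrite h; move: h; rewrite !agree_cat.
  by case/andP => /andP[-> ->] ->.
have in2 g : g \in Xset2 w2 tau -> [/\ agree w2 g (tau ++ K), agree w2 g P2 &
     agree w2 g ((tau ++ K) ++ P2)].
  by rewrite inE => h; rewrite h; move: h; rewrite !agree_cat => /andP[-> ->].
have drop g (a : A u) : ans g u = a -> success g (Ask k) <= success g (k a).
  move=> <-; rewrite /success /untouched /= ler_nat.
  by case: good => //=; case: all; rewrite ?andbF //; case: (_ ==> _).
(* Known or planted: [simulate] answers by itself at no cost in [d], and every world of the first
   posterior gives that same answer. *)
case: (boolP (covered w0 (K ++ P1) u)) => c0.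
  have a1 g : g \in Xset1 w1 tau -> ans g u = ans w0 u.
    move=> /in1[g1 _ _]; rewrite (covered_ans a01 c0) (covered_ans g1) //.
    by rewrite -(covered_agree _ a01).
  apply: le_trans (average_le (psi := fun g => success g (k (ans w0 u))) _) _.
    by move=> g /a1; apply: drop.
  rewrite [leRHS](_ : _ = average (Xset2 w2 tau) (fun g => win g (k (ans w0 u)) d) + d%:R * kappa).
    apply: IH => // g gX; have := hd g gX; rewrite /= (a1 g gX); exact: ltnW.
  by congr (_ + _); apply: average_eq => g _; rewrite /win /= c0.
(* With no budget left, the run in [w1] would already be too long. *)
case: d => [|d] in sz hd *.
  by have := hd w1 (consistent_refl _ _).
have dk (a : A u) g : ans g u = a -> win g (Ask k) d.+1 = win g (k a) d.
  by move=> <-; rewrite /win /= (negbTE c0).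
(* Being neither planted nor determined by [K], the answer is determined by earlier queries of this
   run, on which both sides agree. *)
case: (boolP (covered w1 (tau ++ K) u)) => c1.
  have a1 g : g \in Xset1 w1 tau -> ans g u = ans w1 u.
    by move=> /in1[_ g1 _]; rewrite (covered_ans g1 c1).
  have a2 g : g \in Xset2 w2 tau -> ans g u = ans w1 u.
    move=> /in2[g1 _ _]; rewrite (covered_ans a12 c1) (covered_ans g1) //.
    by rewrite -(covered_agree _ a12).
  apply: le_trans (average_le (psi := fun g => success g (k (ans w1 u))) _) _.
    by move=> g /a1; apply: drop.
  rewrite (average_eq (phi := fun g => win g (Ask k) d.+1)
    (psi := fun g => win g (k (ans w1 u)) d)); last by move=> g /a2; apply: dk.
  apply: le_trans (IH _ d tau w1 w2 _ _ _ _ _ _ _) _ => //.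
  - by apply: leq_trans sz; rewrite addnS.
  - by move=> g gX; have := hd g gX; rewrite /= (a1 g gX).
  - by rewrite lerD2l ler_wpM2r // ler_nat.
have c1' : ~~ covered w1 ((tau ++ K) ++ P1) u.
  rewrite covered_cat negb_or c1 /=; apply: contra c0.
  by rewrite (covered_agree _ a01) covered_cat => ->; rewrite orbT.
case: (boolP (covered w2 ((tau ++ K) ++ P2) u)) => c2.
  have touched g : g \in Xset1 w1 tau -> success g (Ask k) = 0.
    move=> /in1[_ g1 _]; rewrite /success /untouched /=.
    suff -> : (covered f0 P2 u ==> covered g K u) = false by rewrite andbF.
    apply/negbTE; rewrite negb_imply (covered_agree _ a02); apply/andP; split.
      by move: c2; rewrite covered_cat -(covered_agree _ a12) (negbTE c1).
    move: c1; rewrite (covered_agree _ g1); apply: contra.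
    by rewrite covered_cat => ->; rewrite orbT.
  rewrite (average_eq (psi := fun=> 0) touched) avg_const; last exact: ne.
  apply: addr_ge0; last exact: mulr_ge0.
  apply: divr_ge0 => //; apply: sumr_ge0 => g _.
  by case/andP: (win01 g (Ask k) d.+1).
rewrite -natr1 mulrDl mul1r [_ * kappa + _]addrC.
apply: (compare_step (f := fun g => ans g u)).
- by move=> g; apply: success01.
- by move=> g; apply: win01.
- by rewrite mulr_ge0.
- exact: ne.
- move=> a /set0Pn[g1 /setIdP[g1X /eqP g1a]] /set0Pn[g2 /setIdP[g2X /eqP g2a]].
  have [g11 g12 g13] := in1 _ g1X; have [g21 g22 g23] := in2 _ g2X.
  have e1 : [set g in Xset1 w1 tau | ans g u == a] = Xset1 g1 (u :: tau).
    by rewrite /Xset1 !cat_cons (consistent_cons u g1X) g1a.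
  have e2 : [set g in Xset2 w2 tau | ans g u == a] = Xset2 g2 (u :: tau).
    by rewrite /Xset2 !cat_cons (consistent_cons u g2X) g2a.
  rewrite e1 e2.
  apply: le_trans (average_le (psi := fun g => success g (k a)) _) _.
    by move=> g; rewrite -e1 => /setIdP[_ /eqP]; apply: drop.
  rewrite (average_eq (phi := fun g => win g (Ask k) d.+1)
    (psi := fun g => win g (k a) d)); last first.
    by move=> g; rewrite -e2 => /setIdP[_ /eqP]; apply: dk.
  apply: (IH a d (u :: tau) g1 g2) => //=.
  + by rewrite oku.
  + by apply: leq_trans sz; rewrite !addSn addnS.
  + exact: agree_trans g11.
  + rewrite g1a g2a eqxx /=; apply: agree_trans g21.
    by apply: agree_trans a12; rewrite agree_sym.
  + exact: agree_trans g22.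
  + move=> g; rewrite -e1 => /setIdP[gX /eqP ga].
    by have := hd g gX; rewrite /= ga.
- apply: answers_close => //; last by rewrite all_cat oktau.
  by rewrite size_cat; apply: leq_trans sz; rewrite leq_addr.
Qed.
End Compare.

(** * Learning heavy queries and forging a one-time signature *)

Section OneTimeAttack.
Variables (S : finType) (SKT : Type) (VKT Sig : eqType) (Msg : finType).
Variables (p : S -> R) (gen : S -> tree A (SKT * VKT)).
Variables (sign : SKT -> Msg -> tree A Sig) (ver : VKT -> Msg -> Sig -> tree A bool).
Hypothesis p_ge0 : forall s, 0 <= p s.

Definition world : finType := (S * W)%type.
Implicit Types (x y : world) (Y : {set world}) (L : seq U).

Definition keys x := outcome (ans x.2) (gen x.1).
Definition signature x m := outcome (ans x.2) (sign (keys x).1 m).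
Definition secret x m := trace (ans x.2) (gen x.1) ++ trace (ans x.2) (sign (keys x).1 m).
Definition verifying x m := trace (ans x.2) (ver (keys x).2 m (signature x m)).

Definition transcript s : tree A (seq (Msg * Sig * (bool * seq U))) :=
  bind (gen s) (fun k => collect (fun m => bind (sign k.1 m) (fun sg =>
    bind (logged (ver k.2 m sg)) (fun r => Ret A (m, sg, r)))) (enum Msg)).

Definition asked x := trace (ans x.2) (transcript x.1).

Hypothesis complete : forall x m, 0 < p x.1 ->
  outcome (ans x.2) (ver (keys x).2 m (signature x m)).
Hypothesis few_queries : forall x m, 0 < p x.1 ->
  (size (secret x m) + size (verifying x m) <= q)%N.
Hypothesis transcript_ok : forall s, 0 < p s -> queries_in ok (transcript s).

Lemma transcript_outcome h s : let k := outcome h (gen s) in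
  outcome h (transcript s) =
  [seq (m, outcome h (sign k.1 m), (outcome h (ver k.2 m (outcome h (sign k.1 m))),
     trace h (ver k.2 m (outcome h (sign k.1 m))))) | m <- enum Msg].
Proof.
rewrite /= outcome_bind outcome_collect; apply: eq_map => m /=.
by rewrite !outcome_bind outcome_logged.
Qed.

Lemma askedE x : asked x = trace (ans x.2) (gen x.1) ++
  flatten [seq trace (ans x.2) (sign (keys x).1 m) ++ verifying x m | m <- enum Msg].
Proof.
rewrite /asked trace_bind trace_collect; congr (_ ++ flatten _).
by apply: eq_map => m /=; rewrite !trace_bind trace_logged /= cats0.
Qed.

Lemma verifying_asked x m : {subset verifying x m <= asked x}.
Proof.
move=> u uv; rewrite askedE mem_cat; apply/orP; right; apply/flatten_mapP.
by exists m; rewrite ?mem_enum // mem_cat uv orbT.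
Qed.

Lemma secret_asked x m : {subset secret x m <= asked x}.
Proof.
move=> u; rewrite askedE !mem_cat => /orP[-> //|us]; apply/orP; right.
by apply/flatten_mapP; exists m; rewrite ?mem_enum // mem_cat us.
Qed.

Lemma secret_agree s g h m : agree g h (secret (s, g) m) ->
  [/\ keys (s, h) = keys (s, g), signature (s, h) m = signature (s, g) m
    & secret (s, h) m = secret (s, g) m].
Proof.
rewrite /secret /signature /keys /= => a; move: (a); rewrite agree_cat => /andP[a1 a2].
have [e1 e2] := agree_outcome a1 (fun u => id).
have [e3 e4] := agree_outcome a2 (fun u => id).
by rewrite e1 e2 e3 e4.
Qed.

Section Challenge.
Variable m0 : Msg.

Lemma asked_size x : 0 < p x.1 -> (size (asked x) <= #|Msg| * q)%N.
Proof.
move=> px; rewrite askedE size_cat size_flatten /shape -map_comp sumnE big_map.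
(* The run generates the keys once, whereas this sum counts that once per message; [m0] witnesses
   that there is a message at all. *)
apply: (@leq_trans (\sum_(m <- enum Msg) (size (secret x m) + size (verifying x m)))%N).
  rewrite [leqRHS](eq_bigr (fun m => size (trace (ans x.2) (gen x.1)) +
     size (trace (ans x.2) (sign (keys x).1 m) ++ verifying x m))%N); last first.
    by move=> m _; rewrite /secret !size_cat addnA.
  rewrite big_split /= leq_add2r big_enum /= (bigD1 m0) //= leq_addr //.
rewrite big_enum /= -sum_nat_const; apply: leq_sum => m _; exact: few_queries.
Qed.

Definition unlucky x m := [forall (m' | m' != m), has (fun u =>
  covered x.2 (secret x m) u && ~~ covered x.2 (verifying x m) u) (verifying x m')].

Definition view x := ((keys x).2, signature x m0).

Definition mass Y := \sum_(x in Y) p x.1.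

(** Membership is described relative to an arbitrary member, so no reference world has to be carried
    along and the empty set qualifies. *)
Definition posterior Y L := forall x y, x \in Y ->
  (y \in Y) = [&& 0 < p y.1, view y == view x & agree x.2 y.2 L].

Variable eps : R.
Hypothesis eps_bounds : 0 <= eps < 1.

Definition heavy Y L u := eps * mass Y <
  \sum_(x in Y) p x.1 * ((u \in asked x) && ~~ covered x.2 L u)%:R.

Definition forgeable x L (e : Msg * Sig * (bool * seq U)) :=
  [&& e.1.1 != m0, e.2.1 &
      all (fun u => covered x.2 (secret x m0) u ==> covered x.2 L u) e.2.2].

Let cost := (#|Msg| * q)%N.

Definition forgery x L : tree A (option (Msg * Sig)) :=
  bind (simulate x.2 (L ++ secret x m0) (transcript x.1) cost) (fun o =>
    Ret A (obind (fun r => omap fst (ohead [seq e <- r | forgeable x L e])) o)).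

(** The last conjunct keeps every query of the final verification among the allowed ones, so that
    its result carries over from a finite world to the full oracle. *)
Definition wins x (o : option (Msg * Sig)) := if o is Some (m, sg) then
  [&& m != m0, outcome (ans x.2) (ver (keys x).2 m sg)
    & `[< queries_in ok (ver (keys x).2 m sg) >]] else false.

Definition fails x (t : tree A (option (Msg * Sig))) : R :=
  (~~ wins x (outcome (ans x.2) t))%:R.

(** The first term pays for runs that touch the secret of the real world, the second for the drift
    of the answers over [cost] simulated queries. *)
Let theta := 2 * q%:R * eps + cost%:R * kappa.

Lemma theta_ge0 : 0 <= theta.
Proof. by rewrite addr_ge0 // !mulr_ge0 //; case/andP: eps_bounds. Qed.

(** Sampling from the posterior is derandomized: a world is chosen that does no worse than the
    average. By the argument of [finish_bound], one exists for a nonempty posterior without heavy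
    queries. *)
Definition finish Y L :=
  match pselect (exists x, x \in Y /\ \sum_(y in Y) p y.1 * fails y (forgery x L)
      <= \sum_(y in Y) p y.1 * (theta + (unlucky y m0)%:R)) with
  | left e => forgery (projT1 (cid e)) L
  | right _ => Ret A None
  end.

(** Running out of rounds means giving up; [learn_bound] charges for it. *)
Fixpoint learn k Y L : tree A (option (Msg * Sig)) :=
  if k is k'.+1 then
    match pselect (exists u, heavy Y L u) with
    | left e => Ask (fun a : A (projT1 (cid e)) =>
        learn k' [set x in Y | ans x.2 (projT1 (cid e)) == a] (projT1 (cid e) :: L))
    | right _ => finish Y L
    end
  else Ret A None.

Section Finish.
Variables (Y : {set world}) (L : seq U).
Hypotheses (postY : posterior Y L) (okL : all ok L) (light : forall u, ~ heavy Y L u).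
Hypothesis sizeL : (size L + cost <= queries)%N.

Lemma post_p x : x \in Y -> 0 < p x.1.
Proof. by move=> xY; have := postY x xY; rewrite xY => /esym/and3P[]. Qed.

Lemma post_agree x y : x \in Y -> y \in Y -> view y = view x /\ agree x.2 y.2 L.
Proof. by move=> xY; rewrite (postY y xY) => /and3P[_ /eqP ->]. Qed.

Lemma post_class s g h : (s, g) \in Y -> h \in consistent g (L ++ secret (s, g) m0) ->
  (s, h) \in Y /\
  consistent h (L ++ secret (s, h) m0) = consistent g (L ++ secret (s, g) m0).
Proof.
move=> gY; rewrite inE => a; move: (a); rewrite agree_cat => /andP[aL aP].
have [e1 e2 e3] := secret_agree aP; split.
  by rewrite (postY _ gY) /view e1 e2 eqxx aL (post_p gY).
rewrite e3; apply/esym/consistent_eq; exact: a.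
Qed.

(** For a fixed seed, [post_class] splits the posterior into classes of worlds with a common secret;
    [p] depends on the seed only, so [sum_average_class] applies. *)
Lemma post_average (psi : S -> W -> R) :
  \sum_(x in Y) p x.1 * average (consistent x.2 (L ++ secret x m0)) (psi x.1)
  = \sum_(x in Y) p x.1 * psi x.1 x.2.
Proof.
have sumY F : \sum_(x in Y) F x.1 x.2 = \sum_s \sum_(g in [set g | (s, g) \in Y]) F s g :> R.
  rewrite [RHS](eq_bigr (fun s => \sum_(g | (s, g) \in Y) F s g)); last first.
    by move=> s _; apply: eq_bigl => g; rewrite inE.
  rewrite pair_big_dep /=; apply: eq_big => [[]|] //.
rewrite [LHS](sumY (fun s g => p s * average (consistent g (L ++ secret (s, g) m0)) (psi s))).
rewrite (sumY (fun s g => p s * psi s g)); apply: eq_bigr => s _.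
rewrite -!mulr_sumr; congr (_ * _).
apply: (@sum_average_class _ _ _ (fun g => consistent g (L ++ secret (s, g) m0))).
  by move=> g; apply: consistent_refl.
by move=> g h; rewrite inE => gY /(post_class gY)[hY ->]; rewrite inE.
Qed.

(* The verification of the signature received asks the same first query in every
   world of the posterior, so that query is heavy unless already known, and so on. *)
Lemma verifying_covered x : x \in Y -> all (covered x.2 L) (verifying x m0).
Proof.
move=> xY.
have main (t : tree A bool) : (forall y, y \in Y -> {subset trace (ans y.2) t <= asked y}) ->
    all (covered x.2 L) (trace (ans x.2) t).
  elim: t => //= u k IH hsub.
  have cu : covered x.2 L u.
    apply: contrapT => ncu; apply: (light (u := u)); rewrite /heavy.
    rewrite [ltRHS](_ : _ = mass Y).
      rewrite -[ltRHS]mul1r ltr_pM2r; first by case/andP: eps_bounds.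
      rewrite /mass (bigD1 x) //=; apply: ltr_wpDr; last exact: post_p.
      by apply: sumr_ge0.
    apply: eq_bigr => y yY; rewrite hsub ?inE ?eqxx //=.
    rewrite -(covered_agree u (proj2 (post_agree xY yY))).
    by move/negP: ncu => ->; rewrite mulr1.
  rewrite cu /=; apply: IH => y yY v vt; apply: hsub => //.
  by rewrite inE -(covered_ans (proj2 (post_agree xY yY)) cu) vt orbT.
apply: main => y yY.
have [e _] := post_agree xY yY; case: e => <- <-; exact: verifying_asked.
Qed.

(** Luck provides a message whose verification meets the secret only inside the verification for
    [m0], and that part is known by [verifying_covered]. *)
Lemma lucky_forgeable x : x \in Y -> ~~ unlucky x m0 ->
  has (forgeable x L) (outcome (ans x.2) (transcript x.1)).
Proof.
move=> xY /forallPn[m]; rewrite negb_imply => /andP[mm0 /hasPn hm].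
rewrite transcript_outcome has_map; apply/hasP; exists m; first by rewrite mem_enum.
rewrite /forgeable /= mm0 complete ?post_p //=.
apply/allP => u /hm; rewrite negb_and negbK => /orP[/negbTE -> //|].
move=> /mapP[v vv e]; apply/implyP => _; rewrite /covered e.
exact: (allP (verifying_covered xY)).
Qed.

(** A union bound over the queries that reveal a cell of the secret of [y]; none of them is
    heavy. *)
Lemma touched_mass y : y \in Y ->
  \sum_(x in Y) p x.1 * (~~ untouched y.2 L (secret y m0) x.2 (transcript x.1))%:R
  <= 2 * q%:R * eps * mass Y.
Proof.
move=> yY.
(* All queries, in either direction, that share a cell with a secret query of [y]: at most two for
   each. *)
pose duals := flatten [seq projT1 (cid2 (cell_two y.2 v)) | v <- secret y m0].
have sz : (size duals <= 2 * q)%N.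
  have qs : (size (secret y m0) <= q)%N.
    by apply: leq_trans (few_queries m0 (post_p yY)); rewrite leq_addr.
  apply: (@leq_trans (2 * size (secret y m0))%N); last by rewrite leq_mul2l.
  rewrite /duals; elim: (secret y m0) => //= v l IH; rewrite size_cat mulnS leq_add //.
  by case: cid2.
apply: (@le_trans _ _ (\sum_(u <- duals) \sum_(x in Y)
     p x.1 * ((u \in asked x) && ~~ covered x.2 L u)%:R)).
  rewrite exchange_big /=; apply: ler_sum => x xY; rewrite -mulr_sumr ler_wpM2l //.
  rewrite -natr_sum ler_nat; case: (boolP (untouched _ _ _ _ _)) => //= /allPn[u ut].
  rewrite negb_imply => /andP[/mapP[v vs e] nc].
  have ud : u \in duals.
    by apply/flatten_mapP; exists v => //; case: cid2 => l /= _; apply.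
  by rewrite (big_rem u) //= ut nc.
apply: (@le_trans _ _ (\sum_(u <- duals) eps * mass Y)).
  by apply: ler_sum => u _; rewrite leNgt; apply/negP/light.
rewrite big_const_seq count_predT iter_addr_0 -[leLHS]mulr_natl -[leRHS]mulrA ler_wpM2r //.
  by rewrite mulr_ge0 ?sumr_ge0 //; case/andP: eps_bounds.
by rewrite -natrM ler_nat.
Qed.

(** A completed simulation is a run under the overridden oracle [h]. The verification of the chosen
    entry meets the planted secret of [x] only in cells known from [L], and there [h] agrees with
    the real world [y]. *)
Lemma forgery_wins x y : x \in Y -> y \in Y ->
  option_good (has (forgeable x L))
    (outcome (ans y.2) (simulate x.2 (L ++ secret x m0) (transcript x.1) cost)) ->
  wins y (outcome (ans y.2) (forgery x L)).
Proof.
move=> xY yY; rewrite /forgery outcome_bind /=.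
case E : (outcome _ _) => [r|] //= hr; have {E} := simulate_outcome E.
set h := override _ _ _ => er.
have hsec u : u \in secret x m0 -> ans x.2 u = h u.
  by move=> us; rewrite /h /override covered_mem // mem_cat us orbT.
(* The key generation queries belong to the planted secret, so [h] reproduces the keys of [x]. *)
have [ek _] : outcome h (gen x.1) = keys x /\ trace h (gen x.1) = trace (ans x.2) (gen x.1).
  by apply: outcome_trace_eq => u ug; apply: hsec; rewrite mem_cat ug.
move: hr; rewrite has_filter; case F : (filter _ _) => [|e l] //= _.
have : e \in [seq e <- r | forgeable x L e] by rewrite F inE eqxx.
rewrite mem_filter -er transcript_outcome ek => /andP[fe /mapP[m mM ee]].
move: fe; rewrite ee /forgeable /= => /and3P[-> b tV] /=.
set sg := outcome h (sign _ m) in b tV *.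
have [[-> _] aL] := post_agree xY yY.
apply/andP; split.
  have [-> _ //] : outcome (ans y.2) (ver (keys x).2 m sg) = outcome h (ver (keys x).2 m sg) /\
      trace (ans y.2) (ver (keys x).2 m sg) = trace h (ver (keys x).2 m sg).
    apply: outcome_trace_eq => u /(allP tV) /implyP c; rewrite /h /override.
    case: ifP => //; rewrite covered_cat => cu; apply: (covered_ans aL).
    by case/orP: cu.
apply/asboolP; have := transcript_ok (post_p xY).
move=> /(queries_in_bind_inv h)[_ /(queries_in_collect_inv h)/(_ m mM)].
move=> /(queries_in_bind_inv h)[_ /(queries_in_bind_inv h)[/queries_in_logged_inv + _]].
by rewrite ek => ?; assumption.
Qed.

Lemma secret_ok x : x \in Y -> all ok (secret x m0).
Proof.
move=> xY; apply/allP => u /secret_asked.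
by apply/allP/trace_queries_in/transcript_ok/post_p.
Qed.

Lemma secret_size x : x \in Y -> (size (secret x m0) <= q)%N.
Proof. by move=> /post_p px; apply: leq_trans (few_queries m0 px); rewrite leq_addr. Qed.

Let win x (h : W) : R := (option_good (has (forgeable x L))
  (outcome (ans h) (simulate x.2 (L ++ secret x m0) (transcript x.1) cost)))%:R.
Let success (y : world) s (g : W) : R :=
  (has (forgeable (s, g) L) (outcome (ans g) (transcript s)) &&
   untouched y.2 L (secret y m0) g (transcript s))%:R.

(** The test depends on the world only through what [L] and the secret reveal, hence is constant on
    each class of [post_average]. *)
Lemma forgeable_agree s g h : agree g h (L ++ secret (s, g) m0) ->
  forgeable (s, h) L =1 forgeable (s, g) L.
Proof.
rewrite agree_cat => /andP[aL aP] e; rewrite /forgeable /=.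
have [_ _ ->] := secret_agree aP.
congr [&& _, _ & _]; apply: eq_all => u.
by rewrite (covered_agree u aL) (covered_agree u aP).
Qed.

Lemma simulate_pair x y : x \in Y -> y \in Y ->
  average (consistent x.2 (L ++ secret x m0)) (success y x.1)
  <= average (consistent y.2 (L ++ secret y m0)) (win x) + cost%:R * kappa.
Proof.
case: x => s g gY yY /=.
have := @simulate_compare _ g y.2 L (secret (s, g) m0) (secret y m0)
  (has (forgeable (s, g) L)) okL (secret_ok gY) (secret_ok yY) (secret_size gY)
  (secret_size yY) cost (transcript s) [::] g y.2.
rewrite /= add0n => /(_ (transcript_ok (post_p gY)) isT sizeL (agree_refl _ _)).
move=> /(_ (proj2 (post_agree gY yY)) (agree_refl _ _)) h.
apply: le_trans (h _).
  apply: average_le => k; rewrite inE => ak; rewrite ler_nat /success.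
  by rewrite (eq_has (forgeable_agree ak)).
move=> k kc; have [kY _] := post_class gY kc.
exact: (asked_size (post_p kY)).
Qed.

(** For independent [x] and [y] from the posterior, planting the secret of [x] into the world [y]
    fails with at most the stated mass on average, so some fixed [x] achieves it. *)
Lemma finish_bound : \sum_(y in Y) p y.1 * fails y (finish Y L)
  <= \sum_(y in Y) p y.1 * (theta + (unlucky y m0)%:R).
Proof.
rewrite /finish; case: pselect => [e|ne]; first by case: cid => x /= [].
have [->|/set0Pn[x0 x0Y]] := eqVneq Y finset.set0; first by rewrite !big_set0.
exfalso; apply: ne.
apply: contrapT => /forallNP ne.
set B := \sum_(y in Y) p y.1 * (theta + (unlucky y m0)%:R) in ne.
have M0 : 0 < mass Y.
  by rewrite /mass (bigD1 x0) //= ltr_wpDr ?(post_p x0Y) // sumr_ge0.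
have lt x : x \in Y -> p x.1 * B <
    \sum_(y in Y) p x.1 * (p y.1 * (1 - win x y.2)).
  move=> xY; rewrite -mulr_sumr ltr_pM2l ?post_p // ltNge; apply/negP => le.
  apply: (ne x); split => //; apply: le_trans le.
  apply: ler_sum => y yY; rewrite ler_wpM2l // /fails /win.
  move: (@forgery_wins x y xY yY).
  case: (option_good _ _) => [/(_ isT) ->|_]; first by rewrite subrr.
  by rewrite subr0 lern1 leq_b1.
have : \sum_(x in Y) p x.1 * B <
    \sum_(x in Y) \sum_(y in Y) p x.1 * (p y.1 * (1 - win x y.2)).
  rewrite [ltLHS](bigD1 x0) //= [ltRHS](bigD1 x0) //=.
  by apply: ltr_leD; [exact: lt | apply: ler_sum => x /andP[/lt/ltW]].
rewrite -mulr_suml -/(mass Y) ltNge => /negP; apply.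
rewrite exchange_big /=.
(* A genuine run in [x] is lost only if [x] is unlucky or the run touches the secret of [y];
   [touched_mass] bounds the latter. *)
have low y : y \in Y -> mass Y * (1 - 2 * q%:R * eps) - \sum_(x in Y) p x.1 * (unlucky x m0)%:R
    <= \sum_(x in Y) p x.1 * success y x.1 x.2.
  move=> yY; apply: le_trans (_ : \sum_(x in Y) p x.1 * (1 - (unlucky x m0)%:R -
    (~~ untouched y.2 L (secret y m0) x.2 (transcript x.1))%:R) <= _); last first.
    apply: ler_sum => x xY; rewrite ler_wpM2l // /success -surjective_pairing.
    case: (boolP (unlucky x m0)) => [_|/(lucky_forgeable xY) ->].
      by rewrite subrr sub0r (@le_trans _ _ 0) // oppr_le0.
    by rewrite subr0; case: (untouched _ _ _ _ _); rewrite ?subrr ?subr0.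
  rewrite [leRHS](eq_bigr (fun x => p x.1 - p x.1 * (unlucky x m0)%:R -
    p x.1 * (~~ untouched y.2 L (secret y m0) x.2 (transcript x.1))%:R)); last first.
    by move=> x _; rewrite !mulrBr mulr1.
  rewrite !sumrB -/(mass Y); have := touched_mass yY; lra.
(* By [post_average], both [x] and [y] may be replaced by averages over their classes, and these are
   what [simulate_pair] compares. *)
have key : \sum_(y in Y) p y.1 * (mass Y * (1 - theta) - \sum_(x in Y) p x.1 * (unlucky x m0)%:R)
    <= \sum_(y in Y) \sum_(x in Y) p y.1 * (p x.1 * win x y.2).
  rewrite [leRHS]exchange_big /=.
  rewrite [leRHS](eq_bigr (fun x => p x.1 * \sum_(y in Y) p y.1 *
      average (consistent y.2 (L ++ secret y m0)) (win x))); last first.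
    move=> x xY; rewrite (post_average (fun _ h => win x h)) mulr_sumr.
    by apply: eq_bigr => y _; rewrite mulrCA.
  apply: le_trans (_ : \sum_(x in Y) p x.1 * \sum_(y in Y) p y.1 *
      (average (consistent x.2 (L ++ secret x m0)) (success y x.1) - cost%:R * kappa) <= _);
    last first.
    apply: ler_sum => x xY; rewrite ler_wpM2l //; apply: ler_sum => y yY.
    by rewrite ler_wpM2l // lerBlDr; apply: simulate_pair.
  under [leRHS]eq_bigr => x _ do rewrite mulr_sumr.
  rewrite [leRHS]exchange_big /=; apply: ler_sum => y yY.
  rewrite [leRHS](eq_bigr (fun x => p y.1 *
    (p x.1 * average (consistent x.2 (L ++ secret x m0)) (success y x.1)
     - p x.1 * (cost%:R * kappa)))); last by move=> x _; rewrite mulrCA mulrBr.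
  rewrite -mulr_sumr ler_wpM2l // sumrB (post_average (success y)) -mulr_suml -/(mass Y).
  by have := low y yY; rewrite /theta; lra.
rewrite (eq_bigr (fun y => p y.1 * mass Y - \sum_(x in Y) p y.1 * (p x.1 * win x y.2))); last first.
  move=> y _; rewrite /mass mulr_sumr -sumrB; apply: eq_bigr => x _; ring.
rewrite sumrB -mulr_suml -/(mass Y).
have eB : B = mass Y * theta + \sum_(x in Y) p x.1 * (unlucky x m0)%:R.
  by rewrite /B /mass mulr_suml -big_split /=; apply: eq_bigr => x _; rewrite mulrDr.
move: key; rewrite -mulr_suml -/(mass Y) eB; lra.
Qed.

End Finish.

Lemma fails01 x t : 0 <= fails x t <= 1.
Proof. by rewrite /fails ler0n lern1 leq_b1. Qed.

Definition unknown x L := size [seq u <- asked x | ~~ covered x.2 L u].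

Lemma posterior_cons Y L u (a : A u) : posterior Y L ->
  posterior [set x in Y | ans x.2 u == a] (u :: L).
Proof.
move=> postY x y; rewrite !inE => /andP[xY /eqP xa].
rewrite (postY x y xY) /agree /= xa [a == _]eq_sym -!andbA.
by congr (_ && [&& _, _ & _]); rewrite andbC.
Qed.

(* Asking a heavy query lowers the expected number of unknown queries by at least
   [eps] times the mass. *)
Lemma learn_bound k Y L : posterior Y L -> all ok L ->
  (size L + k + cost <= queries)%N ->
  k%:R * eps * (\sum_(x in Y) p x.1 * fails x (learn k Y L)
    - \sum_(x in Y) p x.1 * (theta + (unlucky x m0)%:R))
  <= \sum_(x in Y) p x.1 * (unknown x L)%:R.
Proof.
have e0 : 0 <= eps by case/andP: eps_bounds.
elim: k Y L => [|k IH] Y L postY okL sz.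
  by rewrite !mul0r; apply: sumr_ge0 => x _; rewrite mulr_ge0.
rewrite /=; case: pselect => [e|light]; last first.
  apply: le_trans (_ : 0 <= _); last by apply: sumr_ge0 => x _; rewrite mulr_ge0.
  rewrite mulr_ge0_le0 ?mulr_ge0 // subr_le0; apply: finish_bound => //.
    by move=> u hu; apply: light; exists u.
  by apply: leq_trans sz; rewrite leq_add2r leq_addr.
case: cid => u hu /=.
have oku : ok u.
  apply: contrapT => nok; move: hu; rewrite /heavy big1 ?ltNge ?mulr_ge0 ?sumr_ge0 //.
  move=> x xY; case: (boolP (u \in asked x)) => [ux|_]; last by rewrite mulr0.
  by case: nok; exact: (allP (trace_queries_in _ (transcript_ok (post_p postY xY))) u ux).
set D := (X in _ * X <= _).
(* Failure never exceeds the whole mass, so one more round adds at most [eps * mass Y] to the left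
   side. *)
have Dle : D <= mass Y.
  rewrite /D lerBlDr; apply: (@le_trans _ _ (mass Y)).
    apply: ler_sum => x _; rewrite -[leRHS]mulr1 ler_wpM2l //.
    by case/andP: (fails01 x (Ask (fun a => learn k [set x in Y | ans x.2 u == a] (u :: L)))).
  by rewrite lerDl sumr_ge0 // => x _; rewrite mulr_ge0 // addr_ge0 // theta_ge0.
have step : k%:R * eps * D <= \sum_(x in Y) p x.1 * (unknown x (u :: L))%:R.
  rewrite /D (sum_fiber _ (fun x => ans x.2 u)) (sum_fiber Y (fun x => ans x.2 u)).
  rewrite [leRHS](sum_fiber _ (fun x => ans x.2 u)) -sumrB mulr_sumr.
  apply: ler_sum => a _.
  have okuL : all ok (u :: L) by rewrite /= oku.
  have szuL : (size (u :: L) + k + cost <= queries)%N by move: sz; rewrite /= addnS addSn.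
  apply: le_trans (IH _ _ (posterior_cons (a := a) postY) okuL szuL).
  rewrite ler_wpM2l ?mulr_ge0 // lerD2r; apply: ler_sum => x.
  by rewrite inE => /andP[_ /eqP xa]; rewrite /fails /= xa.
have drop : \sum_(x in Y) p x.1 * (unknown x (u :: L))%:R + eps * mass Y
    <= \sum_(x in Y) p x.1 * (unknown x L)%:R.
  apply: (@le_trans _ _ (\sum_(x in Y) p x.1 * (unknown x (u :: L))%:R +
    \sum_(x in Y) p x.1 * ((u \in asked x) && ~~ covered x.2 L u)%:R)).
    by rewrite lerD2l ltW.
  rewrite -big_split /=; apply: ler_sum => x _; rewrite -mulrDr ler_wpM2l // -natrD ler_nat.
  rewrite /unknown; move: (asked x) => l.
  have cc v : covered x.2 (u :: L) v = (cell x.2 v == cell x.2 u) || covered x.2 L v.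
    by rewrite /covered /= inE.
  rewrite (eq_filter (a2 := predI (fun v => cell x.2 v != cell x.2 u)
    (fun v => ~~ covered x.2 L v))) => [|v]; last by rewrite /= cc negb_or.
  rewrite filter_predI size_filter; set F := [seq v <- l | ~~ covered x.2 L v].
  rewrite -(count_predC (fun v => cell x.2 v != cell x.2 u) F) leq_add2l.
  case: (boolP (_ && _)) => //= /andP[ul nc]; rewrite -has_count; apply/hasP.
  by exists u; rewrite ?mem_filter ?nc //= eqxx.
rewrite -natr1 mulrDl mul1r mulrDl.
have := ler_wpM2l e0 Dle; lra.
Qed.

Lemma forgery_size x L h : (size (trace h (forgery x L)) <= cost)%N.
Proof. by rewrite trace_bind /= cats0; apply: simulate_size. Qed.

Lemma finish_size Y L h : (size (trace h (finish Y L)) <= cost)%N.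
Proof. by rewrite /finish; case: pselect => // e; apply: forgery_size. Qed.

Lemma learn_size k Y L h : (size (trace h (learn k Y L)) <= k + cost)%N.
Proof.
elim: k Y L => //= k IH Y L; case: pselect => [e|_] /=; last first.
  by apply: leq_trans (finish_size Y L h) _; rewrite leq_addl.
by rewrite addSn ltnS.
Qed.

Lemma finish_ok Y L : {in Y, forall x, 0 < p x.1} -> queries_in ok (finish Y L).
Proof.
move=> pY; rewrite /finish; case: pselect => // e; case: cid => x /= [xY _].
by apply: queries_in_bind => //; apply/simulate_ok/transcript_ok/pY.
Qed.

Lemma heavy_ok Y L u : {in Y, forall x, 0 < p x.1} -> heavy Y L u -> ok u.
Proof.
move=> pY hu; apply: contrapT => nok; move: hu.
have e0 : 0 <= eps by case/andP: eps_bounds.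
rewrite /heavy big1 ?ltNge ?mulr_ge0 ?sumr_ge0 // => x xY.
case: (boolP (u \in asked x)) => [ux|_]; last by rewrite mulr0.
by case: nok; exact: (allP (trace_queries_in _ (transcript_ok (pY x xY))) u ux).
Qed.

Lemma learn_ok k Y L : {in Y, forall x, 0 < p x.1} -> queries_in ok (learn k Y L).
Proof.
elim: k Y L => //= k IH Y L pY; case: pselect => [e|_]; last exact: finish_ok.
case: cid => u hu /=; split; first exact: heavy_ok hu.
by move=> a; apply: IH => x; rewrite inE => /andP[/pY].
Qed.

Definition initial (v : VKT * Sig) : {set world} := [set x | (0 < p x.1) && (view x == v)].

(** At the start at most [cost] queries are unknown and each round removes [eps] of them on average,
    so exhausting [k] rounds has relative mass at most [cost / (k * eps)]. *)
Lemma attack_bound k : (k + cost <= queries)%N -> (0 < k)%N -> 0 < eps ->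
  \sum_(x : world) p x.1 * fails x (learn k (initial (view x)) [::])
  <= \sum_(x : world) p x.1 * (theta + (unlucky x m0)%:R)
     + cost%:R / (k%:R * eps) * \sum_(x : world) p x.1.
Proof.
move=> sz k0 e0; have c0 : 0 < k%:R * eps by rewrite mulr_gt0 ?ltr0n.
rewrite -lerBlDl -(ler_pM2l c0) mulrA [_ * (cost%:R / _)]mulrC divfK ?gt_eqF //.
rewrite -subr_le0 -sumrB mulr_sumr mulr_sumr -sumrB.
apply: (@sum_le0_fibers _ _ _ view) => v.
rewrite sumrB -mulr_sumr sumrB.
have restr (F : world -> R) :
    \sum_(x | view x == v) p x.1 * F x = \sum_(x in initial v) p x.1 * F x.
  rewrite (bigID (fun x => 0 < p x.1)) /= addrC big1 ?add0r.
    by apply: eq_bigl => x; rewrite inE andbC.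
  move=> x /andP[_]; rewrite lt_def p_ge0 andbT negbK => /eqP ->; exact: mul0r.
rewrite (eq_bigr (fun x => p x.1 * fails x (learn k (initial v) [::]))) => [|x /eqP -> //].
rewrite !restr [X in _ - X](eq_bigr (fun x => p x.1 * cost%:R)) => [|x _]; last exact: mulrC.
rewrite restr subr_le0; apply: (le_trans (learn_bound _ _ _)) => //=.
- move=> x y; rewrite !inE => /andP[_ /eqP ->]; by rewrite /agree /= andbT.
- apply: ler_sum => x; rewrite inE => /andP[px _]; rewrite ler_wpM2l // ler_nat.
  by apply: leq_trans (asked_size px); rewrite /unknown size_filter count_size.
Qed.

End Challenge.

Lemma unlucky_bound x : 0 < p x.1 -> (#|[set m | unlucky x m]| <= 2 ^ q)%N.
Proof.
move=> px; pose a m := map (cell x.2) (secret x m); pose b m := map (cell x.2) (verifying x m).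
have szab m : (size (a m) + size (b m) <= q)%N by rewrite !size_map; apply: few_queries.
apply: leq_trans (set_pair_bound szab).
apply: subset_leq_card; apply/subsetP => m; rewrite !inE => /forallP um.
by apply/forallP => m'; apply/implyP => mm'; rewrite has_map; apply: (implyP (um m')).
Qed.

Lemma attack_exists eps k : 0 < eps < 1 -> (0 < k)%N -> (0 < #|Msg|)%N ->
  (k + #|Msg| * q <= queries)%N ->
  exists m0 (attack : VKT -> Sig -> tree A (option (Msg * Sig))),
  [/\ forall v s h, (size (trace h (attack v s)) <= k + #|Msg| * q)%N,
      forall v s, queries_in ok (attack v s)
    & \sum_(x : world) p x.1 *
        (~~ wins m0 x (outcome (ans x.2) (attack (keys x).2 (signature x m0))))%:R
      <= (2 * q%:R * eps + (#|Msg| * q)%:R * kappa + (#|Msg| * q)%:R / (k%:R * eps)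
          + (2 ^ q)%:R / #|Msg|%:R) * \sum_(x : world) p x.1].
Proof.
move=> /andP[e0 e1] k0 M0 sz; have eb : 0 <= eps < 1 by rewrite ltW.
set total := \sum_(x : world) p x.1.
have M0' : 0 < #|Msg|%:R :> R by rewrite ltr0n.
(* An average over the messages: each world of positive weight has at most [2 ^ q] unlucky ones. *)
have [m0 hm0] : exists m0, #|Msg|%:R * (\sum_(x : world) p x.1 * (unlucky x m0)%:R)
    <= (2 ^ q)%:R * total.
  apply: contrapT => /forallNP ne.
  have : \sum_(m : Msg) (2 ^ q)%:R * total <
      \sum_(m : Msg) #|Msg|%:R * (\sum_(x : world) p x.1 * (unlucky x m)%:R).
    apply: ltr_sum; last by move=> m _; rewrite ltNge; apply/negP/ne.
    have /card_gt0P[m _] := M0.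
    by apply/hasP; exists m; rewrite ?mem_index_enum.
  rewrite sumr_const -[ltLHS]mulr_natl -mulr_sumr. rewrite ltr_pM2l // ltNge => /negP; apply.
  rewrite exchange_big /= /total mulr_sumr; apply: ler_sum => x _.
  rewrite -mulr_sumr mulrC; have [->|px] := eqVneq (p x.1) 0; first by rewrite !mulr0.
  rewrite ler_wpM2r // -natr_sum ler_nat.
  have := unlucky_bound (x := x); rewrite lt_def px p_ge0 => /(_ isT).
  apply: leq_trans; rewrite -sum1_card [leqRHS]big_mkcond /=.
  by apply: leq_sum => m _; rewrite inE; case: (unlucky x m).
exists m0, (fun v s => learn m0 eps k (initial m0 (v, s)) [::]); split.
- by move=> v s h; apply: learn_size.
- by move=> v s; apply: learn_ok => // x; rewrite inE => /andP[].
have := @attack_bound m0 eps eb k sz k0 e0; rewrite /fails /view => h.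
apply: (le_trans h).
rewrite (eq_bigr (fun x : world => (2 * q%:R * eps + (#|Msg| * q)%:R * kappa) * p x.1 +
   p x.1 * (unlucky x m0)%:R)); last by move=> x _; rewrite mulrDr mulrC.
rewrite big_split /= -mulr_sumr -/total.
have : \sum_(x : world) p x.1 * (unlucky x m0)%:R <= (2 ^ q)%:R / #|Msg|%:R * total.
  by rewrite mulrAC ler_pdivlMr // mulrC.
lra.
Qed.

End OneTimeAttack.
End Attack.

(** * Families of random permutations *)

Section UniformFrequencies.
Variable R : realFieldType.

(** The maps [phi] inject each fibre over [Y] into every other one, so these fibres all have the
    same size. *)
Lemma uniform_frequency (T B : finType) (X : {set T}) (f : T -> B) (Y : {set B}) :
  X != finset.set0 -> (forall g, g \in X -> f g \in Y) ->
  (forall a b, a \in Y -> b \in Y -> exists2 phi : T -> T, injective phi &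
     forall g, g \in X -> f g = a -> phi g \in X /\ f (phi g) = b) ->
  forall a, frequency R X f a = (a \in Y)%:R / #|Y|%:R.
Proof.
move=> X0 fY sym a; rewrite /frequency.
have [aY|aY] := boolP (a \in Y); last first.
  rewrite (_ : [set g in X | _] = finset.set0) ?cards0 ?mul0r //.
  apply/setP => g; rewrite !inE; apply/negbTE; apply: contra aY.
  by move=> /andP[/fY + /eqP <-].
have le b c : b \in Y -> c \in Y ->
    (#|[set g in X | f g == b]| <= #|[set g in X | f g == c]|)%N.
  move=> bY cY; have [phi inj hphi] := sym b c bY cY.
  rewrite -(card_imset _ inj); apply: subset_leq_card; apply/subsetP => _ /imsetP[g + ->].
  by rewrite !inE => /andP[gX /eqP gb]; have [-> ->] := hphi g gX gb; rewrite eqxx.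
have cX : #|X|%:R = #|Y|%:R * #|[set g in X | f g == a]|%:R :> R.
  rewrite -sum1_card natr_sum (sum_fiber X f) (bigID (mem Y)) /= [X in _ + X]big1 ?addr0.
    rewrite (eq_bigr (fun=> #|[set g in X | f g == a]|%:R)).
      by rewrite sumr_const mulr_natl.
    move=> b bY; rewrite -natr_sum sum1_card; congr _%:R.
    by apply/eqP; rewrite eqn_leq !le.
  move=> b bY; rewrite big1 // => g; rewrite !inE => /andP[/fY + /eqP fb].
  by rewrite fb (negbTE bY).
have : #|X|%:R != 0 :> R by rewrite pnatr_eq0 cards_eq0.
rewrite cX mulf_eq0 negb_or => /andP[Y0 a0].
by rewrite mul1r invfM mulrCA divff // mulr1.
Qed.

(** The elements of [Y1] outside [Y2] weigh at most [q / n] together. On the common part only the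
    densities differ, and since the sizes differ by at most [q] this again costs at most [q / n]. *)
Lemma uniform_close (B : finType) (Y1 Y2 : {set B}) (q n : nat) :
  (#|Y1 :\: Y2| <= q)%N -> (#|Y2 :\: Y1| <= q)%N -> (0 < n)%N ->
  (n <= #|Y1|)%N -> (n <= #|Y2|)%N ->
  \sum_a Num.max 0 ((a \in Y1)%:R / #|Y1|%:R - (a \in Y2)%:R / #|Y2|%:R)
  <= 2 * q%:R / n%:R :> R.
Proof.
move=> d12 d21 n0 n1 n2.
have n0R : 0 < n%:R :> R by rewrite ltr0n.
have Y1R : n%:R <= #|Y1|%:R :> R by rewrite ler_nat.
have Y2R : n%:R <= #|Y2|%:R :> R by rewrite ler_nat.
have p1 := lt_le_trans n0R Y1R; have p2 := lt_le_trans n0R Y2R.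
pose m : R := Num.max 0 (#|Y1|%:R^-1 - #|Y2|%:R^-1).
have m0 : 0 <= m by rewrite le_max lexx.
apply: (@le_trans _ _ (\sum_a ((a \in Y1 :\: Y2)%:R / n%:R + (a \in Y1 :&: Y2)%:R * m))).
  apply: ler_sum => a _; rewrite !inE ge_max.
  have i1 : 0 <= #|Y1|%:R^-1 :> R by rewrite invr_ge0.
  have i2 : 0 <= #|Y2|%:R^-1 :> R by rewrite invr_ge0.
  have i0 : #|Y1|%:R^-1 <= n%:R^-1 :> R by rewrite lef_pV2.
  have hm : #|Y1|%:R^-1 - #|Y2|%:R^-1 <= m by rewrite le_max lexx orbT.
  by case: (a \in Y1); case: (a \in Y2); rewrite /= ?mul1r ?mul0r; apply/andP; split; lra.
rewrite big_split /= -!mulr_suml -!natr_sum.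
have sc (Q : {set B}) : (\sum_a (a \in Q) = #|Q|)%N.
  by rewrite -sum1_card [RHS]big_mkcond /=; apply: eq_bigr => b _; case: (b \in Q).
rewrite !sc.
have h1 : #|Y1 :\: Y2|%:R / n%:R <= q%:R / n%:R :> R.
  by rewrite ler_pM2r ?invr_gt0 // ler_nat.
have h2 : #|Y1 :&: Y2|%:R * m <= q%:R / n%:R.
  rewrite /m; case: (leP (#|Y1|%:R^-1 - #|Y2|%:R^-1) 0) => hle.
    by rewrite mulr0 divr_ge0.
  have i12 : #|Y1 :&: Y2|%:R <= #|Y1|%:R :> R by rewrite ler_nat subset_leq_card ?subsetIl.
  apply: (@le_trans _ _ (#|Y1|%:R * (#|Y1|%:R^-1 - #|Y2|%:R^-1))).
    by rewrite ler_wpM2r // ltW.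
  have c2 : #|Y2|%:R <= #|Y1|%:R + q%:R :> R.
    rewrite -natrD ler_nat -(cardsID Y1 Y2) leq_add //.
    by rewrite subset_leq_card // subsetIr.
  apply: (@le_trans _ _ (q%:R / #|Y2|%:R)).
    rewrite mulrBr divff ?gt_eqF // lerBlDr -mulrDl ler_pdivlMr // mul1r; lra.
  by rewrite ler_wpM2l // lef_pV2.
lra.
Qed.

Lemma card_inj_mem (B : finType) (C : eqType) (s : seq C) (i : B -> C) : injective i ->
  (#|[set b | i b \in s]| <= size s)%N.
Proof.
move=> inj; rewrite cardE -(size_map i); apply: uniq_leq_size.
  by rewrite map_inj_uniq ?enum_uniq.
by move=> c /mapP[b]; rewrite mem_enum inE => + ->.
Qed.

End UniformFrequencies.

Section TaggedOptions.
Variables (I : eqType) (T : I -> eqType).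

Lemma eq_tagged_option i (x y : option (T i)) :
  (existT (fun i => option (T i)) i x == existT (fun i => option (T i)) i y) = (x == y).
Proof. exact: (@eq_Tagged _ (fun i => option (T i)) (existT _ i x) y). Qed.

Lemma neq_tagged_option i j (x : option (T i)) (y : option (T j)) : i != j ->
  (existT (fun i => option (T i)) i x == existT (fun i => option (T i)) j y) = false.
Proof. by move=> /eqP ij; apply/eqP => /(congr1 tag). Qed.

End TaggedOptions.

Section PermQueries.
Variables (I : choiceType) (D : I -> finType).

(* [None] asks for the whole permutation, [Some (true, x)] for the image of [x]
   and [Some (false, y)] for the preimage of [y]. *)
Definition pquery : choiceType := {i : I & option (bool * D i)}.

Definition panswer (u : pquery) : finType :=
  if tagged u is Some _ then D (tag u) else {perm D (tag u)}.

Definition family := forall i, {perm D i}.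

Definition panswer_of i (p : {perm D i}) (o : option (bool * D i)) :
    panswer (Tagged (fun i => option (bool * D i)) o) :=
  match o return panswer (Tagged (fun i => option (bool * D i)) o) with
  | None => p
  | Some (d, x) => if d then p x else (p^-1)%g x
  end.

Definition reply (f : family) (u : pquery) : panswer u :=
  match u with existT i o => panswer_of (f i) o end.

(** A forward query at [x] and a backward query at [f i x] reveal the same pair; its first component
    serves as the cell. *)
Definition input (f : family) (u : pquery) : {i : I & option (D i)} :=
  let: existT i o := u in Tagged (fun i => option (D i))
    (omap (fun dx => if dx.1 then dx.2 else (f i)^-1%g dx.2) o).

Definition output (f : family) (u : pquery) : {i : I & option (D i)} :=
  let: existT i o := u in Tagged (fun i => option (D i))
    (omap (fun dx => if dx.1 then f i dx.2 else dx.2) o).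

Lemma reply_input f1 f2 v : reply f1 v = reply f2 v -> input f1 v = input f2 v.
Proof. by case: v => i [[[] x]|] //= ->. Qed.

Lemma reply_output f1 f2 v : reply f1 v = reply f2 v -> output f1 v = output f2 v.
Proof. by case: v => i [[[] x]|] //= ->. Qed.

Lemma input_output f u v : (input f u == input f v) = (output f u == output f v).
Proof.
case: u => i o; case: v => j o'; have [ij|nij] := eqVneq i j; last first.
  by rewrite /input /output !neq_tagged_option.
case: _ / ij o' => o'; rewrite /input /output !eq_tagged_option.
case: o o' => [[[] x]|] [[[] y]|] //=; rewrite !(inj_eq Some_inj).
- by rewrite (inj_eq perm_inj).
- by rewrite -[in LHS](inj_eq (@perm_inj _ (f i))) permKV.
- by rewrite -[in LHS](inj_eq (@perm_inj _ (f i))) permKV.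
- by rewrite (inj_eq perm_inj).
Qed.

Lemma input_reply f1 f2 u v :
  input f1 u = input f1 v -> reply f1 v = reply f2 v -> reply f1 u = reply f2 u.
Proof.
case: u => i o; case: v => j o'; have [ij|nij] := eqVneq i j; last first.
  by move=> /eqP; rewrite /input neq_tagged_option.
case: _ / ij o' => o' /eqP; rewrite /input eq_tagged_option.
case: o o' => [[[] x]|] [[[] y]|] //=; rewrite ?(inj_eq Some_inj) => /eqP.
- by move=> ->.
- by move=> -> e; rewrite permKV e permKV.
- by move=> <-; rewrite permKV => e; rewrite [in RHS]e permK.
- by move=> /perm_inj ->.
Qed.

Lemma input_agree f1 f2 u v : reply f1 v = reply f2 v ->
  (input f1 u == input f1 v) = (input f2 u == input f2 v).
Proof.
move=> hv; apply/eqP/eqP => e.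
  by rewrite -(reply_input hv) -(reply_input (input_reply e hv)).
by rewrite (reply_input hv) -(reply_input (input_reply e (esym hv))).
Qed.

Lemma input_two f v : exists2 l : seq pquery, (size l <= 2)%N &
  forall u, input f u = input f v -> u \in l.
Proof.
case: v => j o'.
exists (if o' is Some (d, z) then
    [:: Tagged (fun i => option (bool * D i)) (Some (true, if d then z else (f j)^-1%g z));
        Tagged (fun i => option (bool * D i)) (Some (false, if d then f j z else z))]
  else [:: Tagged (fun i => option (bool * D i)) (None : option (bool * D j))]).
  by case: o' => [[]|].
case=> i o; have [ij|nij] := eqVneq i j; last first.
  by move=> /eqP; rewrite /input neq_tagged_option.
case: _ / ij o' => o' /eqP; rewrite /input eq_tagged_option.
case: o o' => [[[] x]|] [[[] y]|] //=; rewrite ?(inj_eq Some_inj) => /eqP; rewrite ?inE.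
- by move=> ->; rewrite eqxx.
- by move=> ->; rewrite eqxx.
- by move=> <-; rewrite permKV eqxx orbT.
- by move=> /perm_inj ->; rewrite eqxx orbT.
- by rewrite eqxx.
Qed.

Section Worlds.
Variables (J : seq I).

Definition pworld : finType := {dffun forall j : seq_sub J, {perm D (ssval j)}}.

(** The identity outside [J] is a default value; allowed queries have their index in [J]. *)
Definition family_of (w : pworld) : family := fun i =>
  match @idP (i \in J) with ReflectT h => w (SeqSub h) | ReflectF _ => 1%g end.

Definition restriction (f : family) : pworld := [ffun j => f (ssval j)].

Lemma family_of_restriction f i : i \in J -> family_of (restriction f) i = f i.
Proof. by rewrite /family_of; case: {-}_ / idP => // h _; rewrite ffunE. Qed.

Lemma restriction_family_of w : restriction (family_of w) = w.
Proof.
apply/ffunP => -[i hi]; rewrite ffunE /family_of /=; case: {-}_ / idP => // h.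
by rewrite (bool_irrelevance h hi).
Qed.

(** Translation by fixed permutations is injective on worlds: [l] relabels inputs and [r] relabels
    outputs. These are the symmetries fed to [uniform_frequency]. *)
Definition shift (l r : family) (w : pworld) : pworld :=
  restriction (fun i => l i * family_of w i * r i)%g.

Lemma shift_inj l r : injective (shift l r).
Proof.
move=> w w' e; rewrite -(restriction_family_of w) -(restriction_family_of w').
apply/ffunP => -[i hi]; rewrite !ffunE /=.
have := congr1 (fun w => family_of w i) e.
by rewrite !family_of_restriction // => /mulIg/mulgI.
Qed.

Lemma family_of_shift l r w i : i \in J ->
  family_of (shift l r w) i = (l i * family_of w i * r i)%g.
Proof. exact: family_of_restriction. Qed.

Definition wreply w := reply (family_of w).
Definition winput w := input (family_of w).

Variables (small : pred I) (backward : bool).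

(** Each index admits either whole-permutation queries or point queries, never both, so the two
    kinds never overlap in what they reveal. *)
Definition valid (u : pquery) := (tag u \in J) &&
  (if tagged u is Some (d, _) then ~~ small (tag u) && (d || backward) else small (tag u)).

Definition fresh_answers w K (u : pquery) : {set panswer u} :=
  match u return {set panswer u} with existT i o =>
    match o return {set panswer (Tagged (fun i => option (bool * D i)) o)} with
    | None => setT
    | Some (true, x) => [set a | Tagged (fun i => option (D i)) (Some a)
         \notin [seq output (family_of w) v | v <- K]]
    | Some (false, x) => [set a | Tagged (fun i => option (D i)) (Some a)
         \notin [seq input (family_of w) v | v <- K]]
    end
  end.

Notation consistent := (consistent wreply).
Notation covered := (covered winput).
Notation agree := (agree wreply).

Lemma fresh_answers_reply w K u g : ~~ covered w K u -> g \in consistent w K ->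
  wreply g u \in fresh_answers w K u.
Proof.
move=> nc; rewrite inE => /allP ag.
have no v : v \in K -> input (family_of g) u != input (family_of g) v.
  move=> vK; have e : reply (family_of w) v = reply (family_of g) v by exact/eqP/ag.
  by rewrite -(input_agree u e); apply: contra nc => /eqP h; apply/mapP; exists v.
case: u {nc} no => i [[[] x]|] no /=; last by rewrite inE.
  rewrite inE; apply/mapP => -[v vK e]; have := no v vK; rewrite input_output.
  by rewrite -(reply_output (eqP (ag v vK))) -e => /eqP; apply.
rewrite inE; apply/mapP => -[v vK e]; have := no v vK.
by rewrite -(reply_input (eqP (ag v vK))) -e => /eqP; apply.
Qed.

Lemma reply_ext f1 f2 v : f1 (tag v) = f2 (tag v) -> reply f1 v = reply f2 v.
Proof. by case: v => i o /= ->. Qed.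

Let one : family := fun=> 1%g.

Lemma shift_out i (s t : {perm D i}) w v : tag v \in J -> i != tag v ->
  wreply (shift (dfwith one s) (dfwith one t) w) v = wreply w v.
Proof.
move=> vJ iv; apply: reply_ext.
by rewrite family_of_shift // !dfwith_out // mul1g mulg1.
Qed.

(** Forwards, swap [a] and [b] after the permutation; backwards, swap them before it. Both are
    fresh, so no recorded answer moves. *)
Lemma fresh_answers_shift w K u a b : valid u -> all valid K -> ~~ covered w K u ->
  a \in fresh_answers w K u -> b \in fresh_answers w K u ->
  exists2 phi : pworld -> pworld, injective phi &
    forall g, g \in consistent w K -> wreply g u = a ->
      phi g \in consistent w K /\ wreply (phi g) u = b.
Proof.
case: u a b => i o a b vu /allP vK nc aF bF.
have iJ : i \in J by case/andP: vu.
suff [s [t hst]] : exists s t : {perm D i}, forall g, g \in consistent w K ->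
    wreply g (existT _ i o) = a ->
    (forall v, v \in K -> tag v = i ->
       wreply (shift (dfwith one s) (dfwith one t) g) v = wreply g v) /\
    wreply (shift (dfwith one s) (dfwith one t) g) (existT _ i o) = b.
  exists (shift (dfwith one s) (dfwith one t)); first exact: shift_inj.
  move=> g gX ga; have [h1 h2] := hst g gX ga; split => //.
  move: gX; rewrite !inE => /allP ag; apply/allP => v vin.
  have [iv|iv] := eqVneq i (tag v); first by rewrite h1 //; apply: ag.
  by rewrite shift_out ?ag //; have /andP[] := vK v vin.
have gin g v : g \in consistent w K -> v \in K ->
    input (family_of w) v = input (family_of g) v /\
    output (family_of w) v = output (family_of g) v.
  rewrite inE => /allP ag vin; split; first exact/reply_input/eqP/ag.
  exact/reply_output/eqP/ag.
case: o a b vu nc aF bF => [[[] x]|] a b vu nc aF bF.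
- exists 1%g, (tperm a b) => g gX ga; split; last first.
    rewrite /wreply /= family_of_shift // !dfwith_in mul1g permM.
    by rewrite -[family_of g i x]/(wreply g (existT _ i (Some (true, x)))) ga tpermL.
  case=> j o' vin /= ji; subst j; have [_ eo] := gin g _ gX vin.
  have nz z : output (family_of g) (existT _ i o') = Tagged (fun i => option (D i)) (Some z) ->
      tperm a b z = z.
    move=> ez; rewrite tpermD //; [move: aF | move: bF]; rewrite inE; apply: contra => /eqP ->;
      by rewrite -ez -eo; apply: (map_f (output (family_of w))).
  have /andP[_] := vK _ vin; case/andP: vu => _ /=.
  case: o' {vin} eo nz => [[[] z]|] /= eo nz; last by move=> /andP[/negbTE ->].
    by move=> _ _; rewrite /wreply /= family_of_shift // !dfwith_in mul1g permM nz.
  move=> _ _; rewrite /wreply /= family_of_shift // !dfwith_in mul1g invMg permM tpermV nz //.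
- exists (tperm a b), 1%g => g gX ga; split; last first.
    rewrite /wreply /= family_of_shift // !dfwith_in mulg1 invMg permM.
    rewrite -[(family_of g i)^-1%g x]/(wreply g (existT _ i (Some (false, x)))).
    by rewrite ga tpermV tpermL.
  case=> j o' vin /= ji; subst j; have [ei _] := gin g _ gX vin.
  have nz z : input (family_of g) (existT _ i o') = Tagged (fun i => option (D i)) (Some z) ->
      tperm a b z = z.
    move=> ez; rewrite tpermD //; [move: aF | move: bF]; rewrite inE; apply: contra => /eqP ->;
      by rewrite -ez -ei; apply: (map_f (input (family_of w))).
  have /andP[_] := vK _ vin; case/andP: vu => _ /=.
  case: o' {vin} ei nz => [[[] z]|] /= ei nz; last by move=> /andP[/negbTE ->].
    by move=> _ _; rewrite /wreply /= family_of_shift // !dfwith_in mulg1 permM nz.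
  move=> _ _; rewrite /wreply /= family_of_shift // !dfwith_in mulg1 invMg permM tpermV nz //.
(* A whole permutation [a] is turned into [b] by right multiplication. No query of [K] has this
   index, as it would have to be the same query. *)
- exists 1%g, (a^-1 * b)%g => g gX ga; split; last first.
    rewrite /wreply /= family_of_shift // !dfwith_in mul1g.
    by rewrite -[family_of g i]/(wreply g (existT _ i None)) ga mulKVg.
  case=> j o' vin /= ji; subst j; have /andP[_] := vK _ vin; case/andP: vu => _ /= si.
  case: o' vin => [[d z]|] vin /=; first by rewrite si.
  by case/negP: nc; apply: covered_mem.
Qed.

Variables (R : realFieldType) (q queries n : nat).
Hypothesis n_gt0 : (0 < n)%N.
Hypothesis large : forall i, i \in J -> ~~ small i -> (queries + q + n <= #|D i|)%N.

(** Each conditional distribution is uniform on the fresh answers. For point queries these sets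
    differ in at most [q] values either way and have at least [n] elements; for a whole permutation
    the two distributions coincide. *)
Lemma perm_answers_close w1 w2 K P1 P2 u : agree w1 w2 K ->
  (size K <= queries)%N -> (size P1 <= q)%N -> (size P2 <= q)%N ->
  valid u -> all valid K -> all valid P1 -> all valid P2 ->
  ~~ covered w1 (K ++ P1) u -> ~~ covered w2 (K ++ P2) u ->
  \sum_a Num.max 0
      (frequency R (consistent w1 (K ++ P1)) (fun g => wreply g u) a
       - frequency R (consistent w2 (K ++ P2)) (fun g => wreply g u) a)
  <= 2 * q%:R / n%:R.
Proof.
move=> /allP ag sK s1 s2 vu vK v1 v2 c1 c2.
have freq w P a : all valid P -> ~~ covered w (K ++ P) u ->
  frequency R (consistent w (K ++ P)) (fun g => wreply g u) a =
    (a \in fresh_answers w (K ++ P) u)%:R / #|fresh_answers w (K ++ P) u|%:R.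
  move=> vP nc; apply: uniform_frequency.
  - by apply/set0Pn; exists w; apply: consistent_refl.
  - by move=> g; apply: fresh_answers_reply.
  - by move=> b c; apply: fresh_answers_shift => //; rewrite all_cat vK.
under eq_bigr => a _ do rewrite !freq //.
have eK_in : [seq input (family_of w1) v | v <- K] = [seq input (family_of w2) v | v <- K].
  by apply/eq_in_map => v vin; apply/reply_input/eqP/ag.
have eK_out : [seq output (family_of w1) v | v <- K] = [seq output (family_of w2) v | v <- K].
  by apply/eq_in_map => v vin; apply/reply_output/eqP/ag.
have inj (i : I) : injective (fun a : D i => Tagged (fun i => option (D i)) (Some a)).
  by move=> a b /eqP; rewrite eq_tagged_option => /eqP[].
have card_fresh (i : I) s : i \in J -> ~~ small i -> (size s <= queries + q)%N ->
    (n <= #|[set a : D i | Tagged (fun i => option (D i)) (Some a) \notin s]|)%N.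
  move=> iJ si ss; have := large iJ si.
  rewrite -(cardsC [set a : D i | Tagged (fun i => option (D i)) (Some a) \in s]).
  have := leq_trans (card_inj_mem s (inj i)) ss.
  rewrite (_ : ~: _ = [set a : D i | Tagged (fun i => option (D i)) (Some a) \notin s]); last first.
    by apply/setP => a; rewrite !inE.
  by move=> le1 le2; rewrite -(leq_add2l (queries + q)) (leq_trans le2) // leq_add2r.
have card_diff (i : I) s t t' : (size t' <= q)%N ->
  (#|[set a : D i | Tagged (fun i => option (D i)) (Some a) \notin s ++ t] :\:
     [set a : D i | Tagged (fun i => option (D i)) (Some a) \notin s ++ t']| <= q)%N.
  move=> st'; apply: leq_trans st'; apply: leq_trans (card_inj_mem t' (inj i)).
  apply: subset_leq_card; apply/subsetP => a; rewrite !inE negbK !mem_cat negb_or.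
  by case/andP => /orP[->|] //; rewrite andbF.
have ss P w (f : family -> pquery -> {i : I & option (D i)}) : (size P <= q)%N ->
    (size [seq f (family_of w) v | v <- K ++ P] <= queries + q)%N.
  by move=> sP; rewrite size_map size_cat leq_add.
case: u vu c1 c2 freq => i [[[] x]|] vu c1 c2 _.
- have /andP[iJ /= /andP[si _]] := vu.
  apply: uniform_close => //=; try by apply: card_fresh => //; apply: ss.
    by rewrite !map_cat eK_out; apply: card_diff; rewrite size_map.
  by rewrite !map_cat eK_out; apply: card_diff; rewrite size_map.
- have /andP[iJ /= /andP[si _]] := vu.
  apply: uniform_close => //=; try by apply: card_fresh => //; apply: ss.
    by rewrite !map_cat eK_in; apply: card_diff; rewrite size_map.
  by rewrite !map_cat eK_in; apply: card_diff; rewrite size_map.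
- rewrite big1 => [|a _]; first by rewrite divr_ge0 ?mulr_ge0.
  by rewrite subrr max_l.
Qed.

End Worlds.
End PermQueries.

From mathcomp Require Import all_classical all_reals all_analysis.
Import numFieldNormedType.Exports.
Local Open Scope classical_set_scope.

(** * Transfer to oracle algorithms *)

Lemma measure_finite_union (R : realType) d (T : measurableType d)
    (mu : {measure set T -> \bar R}) (B : finType) (G : {set B}) (F : B -> set T) :
  (forall b, measurable (F b)) -> (forall b c o, F b o -> F c o -> b = c) ->
  mu (\bigcup_(b in [set` enum G]) F b) = (\sum_(b in G) mu (F b))%E.
Proof.
move=> mF dF; rewrite measure_fin_bigcup //.
- by rewrite -fsbig_seq ?enum_uniq // big_enum.
- by move=> b c _ _ [z [Fb Fc]]; exact: (dF b c z).
Qed.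

Section OracleAlgorithms.
Variable O : perm_oracle.
Implicit Type f : perm_family O.

Fixpoint then_run X Y (a : oracle_alg O X) (k : X -> oracle_alg O Y) : oracle_alg O Y :=
  match a with
  | Return x => k x
  | Query x c => Query (fun r => then_run (c r) k)
  end.

Lemma run_then X Y f (a : oracle_alg O X) (k : X -> oracle_alg O Y) :
  run f (then_run a k) = run f (k (run f a)).
Proof. by elim: a => //= x c IH; rewrite IH. Qed.

Lemma num_queries_then X Y f (a : oracle_alg O X) (k : X -> oracle_alg O Y) :
  num_queries f (then_run a k) = (num_queries f a + num_queries f (k (run f a)))%N.
Proof. by elim: a => //= x c IH; rewrite IH. Qed.

End OracleAlgorithms.

Section Translation.
Variables (I : choiceType) (D : I -> finType) (Q : Type) (An : Q -> Type).
Variable resp : family D -> forall x : Q, An x.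
Let O := @PermOracle I D Q An resp.

Definition perm_at i (p : {perm D i}) (z : bool * D i) : D i :=
  if z.1 then p z.2 else (p^-1)%g z.2.

Variables (loc : Q -> I) (point : forall x, bool * D (loc x)).
Variable out : forall x, D (loc x) -> An x.
(** The form common to both oracles: a query evaluates one permutation at one point in one
    direction. *)
Hypothesis resp_point : forall f x, resp f x = out (perm_at (f (loc x)) (point x)).

Variable backward : bool.
Hypothesis point_ok : forall x, (point x).1 || backward.
Variable probe : forall i, bool * D i -> oracle_alg O (D i).
Hypothesis probe_run : forall (f : perm_family O) i (z : bool * D i), z.1 || backward ->
  run f (probe z) = perm_at (f i) z.
Hypothesis probe_queries : forall (f : perm_family O) i (z : bool * D i), z.1 || backward ->
  (num_queries f (probe z) <= 1)%N.

Variable small : pred I.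
Implicit Type f : perm_family O.

Notation qopt := (fun i => option (bool * D i)).
Notation tree := (tree (@panswer I D)).

(** One query becomes exactly one tree query, even when it is enlarged to a whole small permutation,
    so the bound [q] on the scheme survives. *)
Fixpoint translate X (a : oracle_alg O X) : tree X :=
  match a with
  | Return y => Ret _ y
  | Query x c =>
      if small (loc x)
      then @Ask _ (@panswer I D) X (Tagged qopt (None : qopt (loc x)))
             (fun p => translate (c (out (perm_at p (point x)))))
      else @Ask _ (@panswer I D) X (Tagged qopt (Some (point x)))
             (fun y => translate (c (out y)))
  end.

Lemma translate_outcome X f (a : oracle_alg O X) : outcome (reply f) (translate a) = run f a.
Proof.
elim: a => //= x c IH; rewrite resp_point; case: ifP => _ /=; rewrite IH //.
by rewrite /perm_at; case: (point x).
Qed.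

Lemma translate_size X f (a : oracle_alg O X) :
  size (trace (reply f) (translate a)) = num_queries f a.
Proof.
elim: a => //= x c IH; rewrite resp_point; case: ifP => _ /=; rewrite IH //.
by rewrite /perm_at; case: (point x).
Qed.

Definition shaped (u : pquery D) : bool :=
  if tagged u is Some (d, _) then ~~ small (tag u) && (d || backward) else small (tag u).

Lemma translate_shaped X (a : oracle_alg O X) : queries_in shaped (translate a).
Proof.
elim: a => //= x c IH; case: ifP => sx /=; split => //.
by rewrite /shaped /= sx; case: (point x) (point_ok x).
Qed.

Fixpoint tabulate i (s : seq (D i)) : oracle_alg O (D i -> D i) :=
  if s is x :: s' then
    then_run (probe (true, x)) (fun y =>
    then_run (tabulate s') (fun g => Return O (fun z => if z == x then y else g z)))
  else Return O id.

(** The table is always that of the permutation itself, so the default [1] is never returned. *)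
Definition recover i : oracle_alg O {perm D i} :=
  then_run (tabulate (enum (D i))) (fun g =>
    Return O (odflt 1%g [pick p : {perm D i} | [forall z, p z == g z]])).

Lemma tabulate_run f i (s : seq (D i)) z : z \in s -> run f (tabulate s) z = f i z.
Proof.
elim: s => //= x s IH; rewrite inE !run_then /= probe_run //= /perm_at /=.
by case: eqVneq => [->//|_] /= /IH.
Qed.

Lemma recover_run f i : run f (recover i) = f i.
Proof.
rewrite run_then /=; case: pickP => [p /forallP h|/(_ (f i))] /=.
  by apply/permP => z; rewrite (eqP (h z)) tabulate_run ?mem_enum.
by move=> /negP[]; apply/forallP => z; rewrite tabulate_run ?mem_enum.
Qed.

Lemma recover_queries f i : (num_queries f (recover i) <= #|D i|)%N.
Proof.
rewrite num_queries_then /= addn0 cardE; elim: (enum (D i)) => //= x s IH.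
by rewrite !num_queries_then /= addn0 -add1n leq_add // probe_queries.
Qed.

Definition ask (u : pquery D) : oracle_alg O (panswer u) :=
  match u with existT i o =>
    match o return oracle_alg O (panswer (Tagged qopt o)) with
    | None => recover i
    | Some z => probe z
    end
  end.

Fixpoint emit X (t : tree X) : oracle_alg O X :=
  match t with
  | Ret x => Return O x
  | Ask u k => then_run (ask u) (fun a => emit (k a))
  end.

Lemma ask_run f u : shaped u -> run f (ask u) = reply f u.
Proof.
case: u => i [[d z]|] /=; last by rewrite recover_run.
by rewrite /shaped /= => /andP[_ h]; rewrite probe_run.
Qed.

Lemma emit_run X f (t : tree X) : queries_in shaped t -> run f (emit t) = outcome (reply f) t.
Proof.
elim: t => //= u k IH [su hk]; rewrite run_then ask_run //; exact: IH.
Qed.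

Lemma emit_queries X f (t : tree X) b : (0 < b)%N ->
  (forall i, small i -> (#|D i| <= b)%N) -> queries_in shaped t ->
  (num_queries f (emit t) <= b * size (trace (reply f) t))%N.
Proof.
move=> b0 hb; elim: t => //= u k IH [su hk]; rewrite num_queries_then ask_run // mulnS.
apply: leq_add; last exact: IH.
case: u su {k IH hk} => i [[d z]|] /=; rewrite /shaped /=.
  by move=> /andP[_ h]; apply: leq_trans (probe_queries _ _) _.
by move=> /hb; apply: leq_trans; apply: recover_queries.
Qed.

(** * The attack on a scheme with finitely many seeds *)

Section Scheme.
Variables (R : realType) (n : nat) (S : signature_scheme R O n) (q : nat).
Hypotheses (complete : perfectly_complete S) (total : total_queries_le S q).
Variables (N : nat) (emb : 'I_N -> block n) (k room : nat).
Hypotheses (emb_inj : injective emb) (N_gt0 : (0 < N)%N) (k_gt0 : (0 < k)%N).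
Hypothesis room_gt0 : (0 < room)%N.

(** A permutation of at least this size keeps [room] fresh values after the [k + N * q] queries of
    the attack and [q] private ones. *)
Let bound := (k + N * q + q + room)%N.
Hypothesis small_bound : forall i, small i = (#|D i| < bound)%N.

Variable M : nat.

(* Cutting off at seed [M] leaves finitely many trees, hence finitely many
   permutations that matter. *)
Definition seed_prob (s : 'I_M) : R := fine (gen_coins S [set val s]).

Lemma seed_prob_ge0 s : 0 <= seed_prob s.
Proof. exact: fine_ge0. Qed.

Lemma seed_prob_gt0 s : 0 < seed_prob s -> (0 < gen_coins S [set val s])%E.
Proof.
rewrite /seed_prob; case: (gen_coins S _) (measure_ge0 (gen_coins S) [set val s]) => [r| |] //=.
by rewrite ltxx.
Qed.

Let tgen (s : 'I_M) := translate (gen S s).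
Let tsign sk m := translate (sign S sk (emb m)).
Let tver vk m sg := translate (verify S vk (emb m) sg).

Let indices : seq I := undup (map (@tag _ _)
  (flatten [seq queries_of (transcript tgen tsign tver s) | s <- enum 'I_M])).

Let allowed := @valid I D indices small backward.
Let W := pworld D indices.
Let ans : W -> forall u, panswer u := @wreply I D indices.

Lemma allowedE u : tag u \in indices -> shaped u -> allowed u.
Proof. by rewrite /allowed /valid => ->. Qed.

Lemma allowed_shaped X (t : tree X) : queries_in allowed t -> queries_in shaped t.
Proof. by apply: queries_in_sub => u _ /andP[]. Qed.

Lemma transcript_allowed s : queries_in allowed (transcript tgen tsign tver s).
Proof.
apply: (queries_in_sub (P := shaped)).
  move=> u us; apply: allowedE; rewrite mem_undup; apply: map_f.
  by apply/flatten_mapP; exists s; rewrite ?mem_enum.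
apply: queries_in_bind => [|kv]; first exact: translate_shaped.
apply: queries_in_collect => m; apply: queries_in_bind => [|sg]; first exact: translate_shaped.
by apply: queries_in_bind => //; apply/queries_in_logged/translate_shaped.
Qed.

Lemma outcome_restriction X f (t : tree X) : queries_in allowed t ->
  outcome (ans (restriction indices f)) t = outcome (reply f) t.
Proof.
move=> ok; have [] // := @outcome_trace_eq _ _ X (reply f) (ans (restriction indices f)) t.
move=> u ut; apply: reply_ext; rewrite family_of_restriction //.
by have /andP[] := allP (trace_queries_in (reply f) ok) u ut.
Qed.

Lemma keys_run (x : world W 'I_M) :
  keys ans tgen x = run (family_of x.2 : perm_family O) (gen S x.1).
Proof. exact: translate_outcome. Qed.

Lemma signature_run (x : world W 'I_M) m : signature ans tgen tsign x m =
  run (family_of x.2 : perm_family O)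
    (sign S (run (family_of x.2 : perm_family O) (gen S x.1)).1 (emb m)).
Proof. by rewrite /signature keys_run; apply: translate_outcome. Qed.

Lemma scheme_complete (x : world W 'I_M) m : 0 < seed_prob x.1 ->
  outcome (ans x.2) (tver (keys ans tgen x).2 m (signature ans tgen tsign x m)).
Proof.
move=> /seed_prob_gt0 px; rewrite keys_run signature_run.
rewrite translate_outcome /=.
set f : perm_family O := family_of x.2.
case E : (run f (gen S x.1)) => [SK VK] /=.
rewrite (complete (f := f) (SK := SK)) //; apply: lt_le_trans px _.
by apply: le_measure; rewrite ?inE // => s ->.
Qed.

Lemma scheme_queries (x : world W 'I_M) m : 0 < seed_prob x.1 ->
  (size (secret ans tgen tsign x m) + size (verifying ans tgen tsign tver x m) <= q)%N.
Proof.
move=> /seed_prob_gt0 px; rewrite /secret /verifying keys_run signature_run size_cat.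
rewrite !translate_size.
set f : perm_family O := family_of x.2.
by have := total f px (emb m); case: (run f (gen S x.1)) => [SK VK].
Qed.

(** The list [J] and the set [good] isolate a finite certificate of success, valid for every family
    that restricts to it, so that the probability can be computed by counting. *)
Lemma finite_attack eps : 0 < eps < 1 ->
  exists (A : adversary R O n) (J : seq I) (good : {set 'I_M * pworld D J}),
  [/\ uniq J, adv_coins A [set 0%N] = 1%E,
      forall f r VK sg, (num_queries f (forge A r VK sg) <= bound * (k + N * q))%N,
      forall s f, (s, restriction J f) \in good -> breaks S A f s 0
    & \sum_(x | x \notin good) seed_prob x.1 <=
      (2 * q%:R * eps + (N * q)%:R * (2 * q%:R / room%:R) + (N * q)%:R / (k%:R * eps)
          + (2 ^ q)%:R / N%:R) * \sum_(x : 'I_M * pworld D J) seed_prob x.1].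
Proof.
move=> eps01.
have kappa0 : 0 <= 2 * q%:R / room%:R :> R by rewrite divr_ge0 ?mulr_ge0.
have large i : i \in indices -> ~~ small i -> ((k + N * q) + q + room <= #|D i|)%N.
  by move=> _; rewrite small_bound -leqNgt.
have close := @perm_answers_close I D indices small backward R q (k + N * q) room room_gt0 large.
have M0 : (0 < #|'I_N|)%N by rewrite card_ord.
have kq : (k + #|'I_N| * q <= k + N * q)%N by rewrite card_ord.
have := @attack_exists R _ _ W ans _ (@winput I D indices)
  (fun w1 w2 u v => @input_agree I D (family_of w1) (family_of w2) u v)
  (fun w1 w2 u v => @input_reply I D (family_of w1) (family_of w2) u v)
  (fun w v => input_two (family_of w) v)
  allowed q (k + N * q) _ kappa0 close 'I_M bits bits bits 'I_N seed_prob tgen tsign tver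
  seed_prob_ge0 scheme_complete scheme_queries (fun s _ => transcript_allowed s)
  eps k eps01 k_gt0 M0 kq.
rewrite card_ord => -[m0 [attack [asize aok abound]]].
(* The attack is deterministic, so its coins sit at 0; the pair returned when no forgery is found is
   arbitrary. *)
pose A : adversary R O n := Adversary \d_0%N (fun=> emb m0) (fun _ VK sg =>
  then_run (emit (attack VK sg)) (fun o =>
    Return O (if o is Some (m, sg') then (emb m, sg') else (emb m0, [::])))).
pose good := finset (fun x : world W 'I_M => wins ans allowed tgen tver m0 x
  (outcome (ans x.2) (attack (keys ans tgen x).2 (signature ans tgen tsign x m0)))).
exists A, indices, good; split.
- exact: undup_uniq.
- by rewrite /= diracE mem_set.
- move=> f r VK sg; rewrite num_queries_then /= addn0.
  apply: leq_trans (emit_queries f (b := bound) _ _ _) _.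
  + by rewrite /bound addn_gt0 room_gt0 orbT.
  + by move=> i; rewrite small_bound => /ltnW.
  + exact: allowed_shaped.
  + by rewrite leq_mul2l asize orbT.
- move=> s f; rewrite inE /wins; set x := (s, _).
  have ok0 := transcript_allowed s.
  have [okg _] := queries_in_bind_inv (reply f) ok0.
  have ek : keys ans tgen x = run f (gen S s).
    by rewrite /keys /= outcome_restriction // translate_outcome.
  have es : signature ans tgen tsign x m0 = run f (sign S (run f (gen S s)).1 (emb m0)).
    rewrite /signature ek /= outcome_restriction ?translate_outcome //.
    have [_ okc] := queries_in_bind_inv (reply f) ok0.
    have := queries_in_collect_inv (reply f) okc; move=> /(_ m0); rewrite mem_enum => /(_ isT).
    by move=> /(queries_in_bind_inv (reply f))[+ _]; rewrite translate_outcome.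
  rewrite ek es /= outcome_restriction // /breaks.
  case: (run f (gen S s)) => SK VK /=; rewrite run_then emit_run /=; last exact: allowed_shaped.
  case: (outcome (reply f) (attack VK _)) => [[m sg]|] //= /and3P[mm ev /asboolP okv]; split.
    by move=> /emb_inj e; rewrite e eqxx in mm.
  by move: ev; rewrite outcome_restriction // translate_outcome.
- apply: le_trans abound; rewrite big_mkcond /=; apply: ler_sum => x _.
  by rewrite inE; case: wins; rewrite ?mulr1 ?mulr0.
Qed.

End Scheme.

(** * From counting to probability *)

Section Probability.
Variables (R : realType) (d : measure_display) (Omega : measurableType d).
Variables (P : probability Omega R) (F : Omega -> perm_family O).
Hypothesis randF : random_perm_family P F.

Lemma measurable_perm i (p : {perm D i}) : measurable [set o | F o i = p].
Proof. by case: randF => + _ _; apply. Qed.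

(** Each query splits the event according to the finitely many values of one permutation. *)
Lemma measurable_run X (a : oracle_alg O X) (B : X -> Prop) :
  measurable [set o | B (run (F o) a)].
Proof.
elim: a => /= [x|x c IH].
  have [Bx|nBx] := pselect (B x).
    by rewrite (_ : [set _ | _] = setT) //; apply/seteqP; split.
  by rewrite (_ : [set _ | _] = set0) //; apply/seteqP; split.
rewrite (_ : [set _ | _] = \bigcup_(p in [set: {perm D (loc x)}]) ([set o | F o (loc x) = p] `&`
    [set o | B (run (F o) (c (out (perm_at p (point x)))))])).
  apply: fin_bigcup_measurable; first exact: finite_finset.
  by move=> p _; apply: measurableI; [exact: measurable_perm | exact: IH].
apply/seteqP; split=> o /=.
  by move=> h; exists (F o (loc x)) => //; split => //=; rewrite -resp_point.
by case=> p _ /= [e]; rewrite -e -resp_point.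
Qed.

(** Independence gives every restriction the same probability [c]; these probabilities sum to 1,
    which determines [c]. *)
Lemma restriction_prob (J : seq I) (w : pworld D J) : uniq J ->
  measurable [set o | restriction J (F o) = w] /\
  P [set o | restriction J (F o) = w] = (#|pworld D J|%:R^-1)%:E.
Proof.
move=> uJ; case: randF => mF pF indF.
have E (v : pworld D J) : [set o | restriction J (F o) = v] =
    \bigcap_(i in [set` J]) [set o | F o i \in finset.set1 (family_of v i)].
  apply/seteqP; split=> o /=.
    by move=> <- i iJ /=; rewrite family_of_restriction // inE.
  move=> h; rewrite -[RHS]restriction_family_of; apply/ffunP => -[i iJ].
  by rewrite !ffunE /=; have := h i iJ; rewrite /= inE => /eqP.
have mE v : measurable [set o | restriction J (F o) = v].
  rewrite E; apply: fin_bigcap_measurable; first exact: finite_seq.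
  move=> i _; rewrite (_ : [set _ | _] = [set o | F o i = family_of v i]); first exact: mF.
  by apply/seteqP; split=> o /=; rewrite inE => /eqP.
split; first exact: mE.
pose c : R := \prod_(i <- J) (#|{perm D i}|%:R)^-1.
have PE v : P [set o | restriction J (F o) = v] = c%:E.
  rewrite E (indF J (fun i => finset.set1 (family_of v i))) // /c.
  rewrite -prodEFin; apply: eq_bigr => i _; rewrite -(pF i (family_of v i)).
  by congr (P _); apply/seteqP; split=> o /=; rewrite inE => /eqP.
have := probability_setT P.
rewrite (_ : setT =
  \bigcup_(v in [set` enum [set: pworld D J]%SET]) [set o | restriction J (F o) = v]).
  rewrite measure_finite_union //; last by move=> v1 v2 o /= <- <-.
  rewrite (eq_bigr (fun=> c%:E)) => [h|v _]; last exact: PE.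
  have [] : (\sum_(v in [set: pworld D J]%SET) c)%:E = 1%E by rewrite -sumEFin; exact: h.
  rewrite sumr_const cardsT => e.
  rewrite PE; congr _%:E; apply: (@mulIf _ #|pworld D J|%:R).
    by apply/negP => /eqP z; move: e; rewrite -mulr_natr z mulr0 => /esym/eqP; rewrite oner_eq0.
  rewrite mulVf ?mulr_natr // pnatr_eq0 -lt0n; apply/card_gt0P.
  by exists w.
apply/seteqP; split=> // o _; exists (restriction J (F o)) => //=.
by rewrite mem_enum inE.
Qed.

Lemma breaks_measurable n (S : signature_scheme R O n) (A : adversary R O n) s r :
  measurable [set o | breaks S A (F o) s r].
Proof.
(* The whole game as a single oracle algorithm, to which [measurable_run] applies. *)
pose game := then_run (gen S s) (fun kv => then_run (sign S kv.1 (chosen A r)) (fun sg =>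
  then_run (forge A r kv.2 sg) (fun ms =>
  then_run (verify S kv.2 ms.1 ms.2) (fun b => Return O (ms.1, b))))).
have gameE f : breaks S A f s r <->
    (run f game).1 <> chosen A r /\ (run f game).2 = true.
  rewrite /breaks /game run_then; case: (run f (gen S s)) => SK VK /=.
  by rewrite !run_then /=; case: (run f (forge _ _ _ _)) => m sg /=.
rewrite (_ : [set _ | _] =
  [set o | (fun mb => mb.1 <> chosen A r /\ mb.2 = true) (run (F o) game)]).
  exact: (measurable_run game (fun mb => mb.1 <> chosen A r /\ mb.2 = true)).
by apply/seteqP; split=> o /gameE.
Qed.

(** Good pairs give disjoint boxes inside the event, each fixing the permutations in [J], the seed
    and the adversary's coin 0. *)
Lemma break_prob_ge n (S : signature_scheme R O n) (A : adversary R O n) M (J : seq I)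
    (good : {set 'I_M * pworld D J}) :
  uniq J -> adv_coins A [set 0%N] = 1%E ->
  (forall s f, (s, restriction J f) \in good -> breaks S A f s 0) ->
  ((#|pworld D J|%:R^-1 * \sum_(x in good) seed_prob S x.1)%:E <= break_prob P F S A)%E.
Proof.
move=> uJ A0 hgood; rewrite /break_prob.
set mu := (_ \x _)%E; set Z := [set w | _].
have mZ : measurable Z.
  rewrite (_ : Z = \bigcup_s \bigcup_r (([set o | breaks S A (F o) s r] `*` [set s]) `*` [set r])).
    apply: bigcupT_measurable => s; apply: bigcupT_measurable => r.
    by apply: measurableX => //; apply: measurableX => //; apply: breaks_measurable.
  apply/seteqP; split => [[[z s] r] /= h|[[z s] r] /= [s' _ [r' _ /= [[h /= ->] ->]]]] //.
  by exists s => //; exists r.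
pose E (x : 'I_M * pworld D J) : set (Omega * nat * nat) :=
  ([set o | restriction J (F o) = x.2] `*` [set val x.1]) `*` [set 0%N].
have mE x : measurable (E x).
  by apply: measurableX => //; apply: measurableX => //; case: (restriction_prob x.2 uJ).
have muE x : mu (E x) = (#|pworld D J|%:R^-1 * seed_prob S x.1)%:E.
  rewrite /mu /E product_measure1E //; last first.
    by apply: measurableX => //; case: (restriction_prob x.2 uJ).
  rewrite [X in (X * _)%E]product_measure1E //; last by case: (restriction_prob x.2 uJ).
  have [_ e] := restriction_prob x.2 uJ.
  rewrite [X in (X * _ * _)%E]e [X in (_ * X)%E]A0 mule1 EFinM.
  by rewrite /seed_prob fineK // fin_num_measure.
apply: le_trans (_ : mu (\bigcup_(x in [set` enum good]) E x) <= _)%E; last first.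
  apply: le_measure; rewrite ?inE //.
    by apply: fin_bigcup_measurable => // x _; apply: mE.
  move=> [[z s] r] [x /=]; rewrite mem_enum => xg [[/= ex ->] ->]; rewrite /Z /=.
  by apply: hgood; rewrite ex -surjective_pairing.
have disj x y z : E x z -> E y z -> x = y.
  by case: x y z => [s w] [s' w'] [[z t] r] [[/= <- ->] _] [[/= <- /val_inj ->] _].
have H := measure_finite_union mu good mE disj; rewrite [leRHS]H {H}.
rewrite (eq_bigr (fun x => (#|pworld D J|%:R^-1 * seed_prob S x.1)%:E)); last by move=> x _.
by rewrite mulr_sumr -sumEFin.
Qed.

End Probability.

(** Continuity from below along the initial segments of the seeds. *)
Lemma seeds_mass (R : realType) n (S : signature_scheme R O n) e : 0 < e ->
  exists M, 1 - e <= \sum_(s : 'I_M) seed_prob S s.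
Proof.
move=> e0; pose G M : set nat := [set s | (s < M)%N].
have GE M : gen_coins S (G M) = (\sum_(s : 'I_M) seed_prob S s)%:E.
  rewrite (_ : G M = \bigcup_(s in [set` enum [set: 'I_M]%SET]) [set val s]).
    have H := measure_finite_union (gen_coins S) [set: 'I_M]%SET
      (F := fun s : 'I_M => [set val s]); rewrite [LHS]H //; last first.
      by move=> b c o /= -> /val_inj.
    rewrite -sumEFin; apply: eq_big => [s|s _]; first by rewrite inE.
    by rewrite /seed_prob fineK // fin_num_measure.
  apply/seteqP; split=> s /=; last by case=> t _ ->; exact: ltn_ord.
  by move=> sM; exists (Ordinal sM) => //=; rewrite mem_enum inE.
have : (gen_coins S \o G) M @[M --> \oo] --> gen_coins S (\bigcup_M G M).
  apply: nondecreasing_cvg_mu => //.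
  by move=> m m' mm'; apply/subsetPset => s /= /leq_trans; apply.
rewrite (_ : \bigcup_M G M = setT); last first.
  by apply/seteqP; split => // s _; exists s.+1 => //=; rewrite /G /=.
rewrite probability_setT => /fine_cvg /= cv.
have h1 : 1 - e < 1 by rewrite ltrBlDr ltrDl.
have [M _ hM] := cvgr_gt _ cv _ h1.
by exists M; have := hM M (leqnn M); rewrite /= GE => /ltW.
Qed.

(** With [N = q * 2 ^ q] messages, [k = 2 ^ q * q ^ 5] rounds, threshold [q ^ -2] and room
    [2 * q ^ 4 * 2 ^ q], the attack loses [5 / q]; cutting off the seeds loses another [1 / q]. The
    number of tree queries and the price of each are both [2 ^ q] times a polynomial. *)
Lemma core_attack (R : realType) n (S : signature_scheme R O n) q :
  (1 < q)%N -> (2 * q <= n)%N -> perfectly_complete S -> total_queries_le S q ->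
  (forall i, small i =
    (#|D i| < 2 ^ q * q ^ 5 + q * 2 ^ q * q + q + 2 * q ^ 4 * 2 ^ q)%N) ->
  exists A : adversary R O n,
    (forall f r VK sg, (num_queries f (forge A r VK sg) <= 10 * q ^ 10 * 4 ^ q)%N) /\
    forall (d : measure_display) (Omega : measurableType d) (P : probability Omega R)
      (F : Omega -> perm_family O), random_perm_family P F ->
      ((1 - 6 / q%:R)%:E <= break_prob P F S A)%E.
Proof.
move=> q1 qn complete total smallE; have q0 : (0 < q)%N by apply: ltnW.
set N := (q * 2 ^ q)%N in smallE.
have T0 : (0 < 2 ^ q)%N by rewrite expn_gt0.
have N0 : (0 < N)%N by rewrite muln_gt0 q0.
have Nn : (N <= #|{: block n}|)%N.
  rewrite card_tuple card_bool; apply: (@leq_trans (2 ^ (2 * q))); last by rewrite leq_pexp2l.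
  by rewrite mul2n -addnn expnD leq_mul2r (ltnW (ltn_expl _ _)) ?orbT.
pose emb (m : 'I_N) : block n := enum_val (widen_ord Nn m).
have emb_inj : injective emb.
  by move=> a b /enum_val_inj /(congr1 val) /= /val_inj.
have Q0 : 0 < q%:R :> R by rewrite ltr0n.
have E0 : 0 < (2 ^ q)%:R :> R by rewrite ltr0n.
pose e : R := (q%:R ^+ 2)^-1.
have e01 : 0 < e < 1.
  rewrite /e invr_gt0 exprn_gt0 //= invf_lt1 ?exprn_gt0 //.
  by rewrite exprn_egt1 // ltr1n.
have iq0 : 0 < q%:R^-1 :> R by rewrite invr_gt0.
have [M hM] := seeds_mass S iq0.
have k0 : (0 < 2 ^ q * q ^ 5)%N by rewrite muln_gt0 T0 expn_gt0 q0.
have room0 : (0 < 2 * q ^ 4 * 2 ^ q)%N by rewrite !muln_gt0 !expn_gt0 q0.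
have [A [J [good [uJ A0 Aq Agood Abad]]]] :=
  finite_attack complete total emb_inj N0 k0 room0 smallE M e01.
exists A; split.
  move=> f r VK sg; apply: leq_trans (Aq f r VK sg) _.
  have -> : (4 ^ q = 2 ^ q * 2 ^ q)%N by rewrite -expnMn.
  have p2 : (q ^ 2 <= q ^ 5)%N by rewrite leq_pexp2l.
  have p1 : (q <= q ^ 5)%N by rewrite -[X in (X <= _)%N]expn1 leq_pexp2l.
  have p4 : (q ^ 4 <= q ^ 5)%N by rewrite leq_pexp2l.
  have -> : (10 * q ^ 10 * (2 ^ q * 2 ^ q) = (5 * (q ^ 5 * 2 ^ q)) * (2 * (q ^ 5 * 2 ^ q)))%N.
    by rewrite (_ : 10 = 5 + 5)%N // expnD; move: (q ^ 5)%N (2 ^ q)%N => a b; nia.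
  rewrite /N; have -> : (q * 2 ^ q * q = q ^ 2 * 2 ^ q)%N.
    by rewrite -mulnA [(_ ^ _ * q)%N]mulnC mulnA.
  apply: leq_mul; move: p1 p2 p4 T0;
    by move: (q ^ 5)%N (q ^ 4)%N (q ^ 2)%N (2 ^ q)%N => a b c t; nia.
move=> d Omega P F randF; apply: le_trans (break_prob_ge randF uJ A0 Agood).
rewrite lee_fin.
set W : R := #|_|%:R; set tot := \sum_(x : 'I_M * pworld D J) seed_prob S x.1 in Abad.
have totE : tot = W * \sum_(s : 'I_M) seed_prob S s.
  rewrite /tot -(pair_bigA _ (fun s (w : pworld D J) => seed_prob S s)) /= mulr_sumr.
  by apply: eq_bigr => s _; rewrite sumr_const -[LHS]mulr_natl.
have W0 : 0 < W.
  by rewrite ltr0n; apply/card_gt0P; exists (restriction J (fun=> 1%g)).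
have split : \sum_(x in good) seed_prob S x.1 =
    tot - \sum_(x | x \notin good) seed_prob S x.1.
  by rewrite /tot [X in _ = X - _](bigID (mem good)) /= addrK.
(* The four terms are [2 / q], [1 / q], [1 / q] and [1 / q]. *)
have bnd : 2 * q%:R * e + (N * q)%:R * (2 * q%:R / (2 * q ^ 4 * 2 ^ q)%:R)
    + (N * q)%:R / ((2 ^ q * q ^ 5)%:R * e) + (2 ^ q)%:R / N%:R = 5 / q%:R :> R.
  rewrite /N /e ![in LHS]natrM; move: E0 Q0; move: (2 ^ q)%:R q%:R => t x t0 x0.
  by field; rewrite !gt_eqF.
rewrite bnd in Abad.
have sum0 : 0 <= \sum_(x in good) seed_prob S x.1.
  by apply: sumr_ge0 => x _; apply: seed_prob_ge0.
have -> : 6 / q%:R = 5 / q%:R + q%:R^-1 :> R.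
  by rewrite -[X in _ + X]mul1r -mulrDl; congr (_ / _); ring.
have five0 : 0 <= 5 / q%:R :> R by rewrite divr_ge0.
(* The product estimate at the end needs [1 - 5 / q] positive; otherwise the claimed bound is
   negative. *)
have [neg|pos] := leP (1 - 5 / q%:R) (0 : R).
  apply: (@le_trans _ _ 0); last by rewrite mulr_ge0 // invr_ge0 ltW.
  by move: neg iq0; lra.
rewrite split; apply: (@le_trans _ _ (W^-1 * ((1 - 5 / q%:R) * tot))); last first.
  rewrite ler_pM2l ?invr_gt0 //; move: Abad; lra.
rewrite totE mulrCA mulKf ?gt_eqF //; set a := 5 / _ in five0 pos *.
set b := \sum_s _ in hM *; move: five0 pos hM iq0; set c := q%:R^-1 => f0 ps hb c0.
by apply: (@le_trans _ _ ((1 - a) * (1 - c))); [nra | rewrite ler_pM2l].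
Qed.

End Translation.

(** * The two oracles *)

Lemma ideal_cipher_attack (R : realType) m n (S : signature_scheme R (ideal_cipher m) n) q :
  (1 < q)%N -> (2 * q <= n)%N -> perfectly_complete S -> total_queries_le S q ->
  exists A : adversary R (ideal_cipher m) n,
    (forall f r VK sg, (num_queries f (forge A r VK sg) <= 10 * q ^ 10 * 4 ^ q)%N) /\
    forall (d : measure_display) (Omega : measurableType d) (P : probability Omega R)
      (F : Omega -> perm_family (ideal_cipher m)), random_perm_family P F ->
      ((1 - 6 / q%:R)%:E <= break_prob P F S A)%E.
Proof.
move=> q1 qn cS tS.
pose D (_ : bits) : finType := block m.
pose Q := (bits * block m * direction)%type.
pose resp (f : family D) (x : Q) : block m :=
  let: (k, y, d) := x in match d with Forward => f k y | Backward => (f k)^-1%g y end.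
pose loc (x : Q) : bits := x.1.1.
pose point (x : Q) : bool * D (loc x) := (if x.2 is Forward then true else false, x.1.2).
pose probe (k : bits) (z : bool * D k) : oracle_alg (ideal_cipher m) (D k) :=
  @Query (ideal_cipher m) _ (k, z.2, if z.1 then Forward else Backward)
    (fun y => Return (ideal_cipher m) y).
(* The argument [true] for [backward] reflects that the cipher answers inverse queries. *)
apply: (@core_attack _ D Q (fun=> block m) resp loc point (fun _ y => y)
  _ true _ probe _ _
  (fun i => (#|D i| < 2 ^ q * q ^ 5 + q * 2 ^ q * q + q + 2 * q ^ 4 * 2 ^ q)%N) R n S q
  q1 qn cS tS) => //.
- by move=> f [[k y] []].
- by move=> x; rewrite orbT.
- by move=> f k [[] y] _.
Qed.

Lemma random_permutation_attack (R : realType) n (S : signature_scheme R random_permutation n) q :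
  (1 < q)%N -> (2 * q <= n)%N -> perfectly_complete S -> total_queries_le S q ->
  exists A : adversary R random_permutation n,
    (forall f r VK sg, (num_queries f (forge A r VK sg) <= 10 * q ^ 10 * 4 ^ q)%N) /\
    forall (d : measure_display) (Omega : measurableType d) (P : probability Omega R)
      (F : Omega -> perm_family random_permutation), random_perm_family P F ->
      ((1 - 6 / q%:R)%:E <= break_prob P F S A)%E.
Proof.
move=> q1 qn cS tS.
pose D (m : nat) : finType := block m.
pose Q := {m : nat & block m}.
pose resp (f : family D) (x : Q) : block (tag x) := f (tag x) (tagged x).
pose point (x : Q) : bool * D (tag x) := (true, tagged x).
pose probe (m : nat) (z : bool * D m) : oracle_alg random_permutation (D m) :=
  @Query random_permutation _ (Tagged (fun m : nat => block m) z.2)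
    (fun y => Return random_permutation y).
(* Here [backward] is [false]; small permutations are still recovered, since [tabulate] probes
   forwards only. *)
apply: (@core_attack _ D Q (fun x => block (tag x)) resp (@tag _ _) point (fun _ y => y)
  _ false _ probe _ _
  (fun i => (#|D i| < 2 ^ q * q ^ 5 + q * 2 ^ q * q + q + 2 * q ^ 4 * 2 ^ q)%N) R n S q
  q1 qn cS tS) => //.
by move=> f m [[] y].
Qed.

(** * Asymptotic form of the bounds *)

Lemma trivial_adversary (R : realType) (O : perm_oracle) n : exists A : adversary R O n,
  forall f r VK sg, num_queries f (forge A r VK sg) = 0.
Proof.
by exists (Adversary \d_0%N (fun=> [tuple of nseq n false])
  (fun _ _ _ => Return O ([tuple of nseq n false], [::]))).
Qed.

(** [harmonic q] is [1 / (q + 1)], and [12 / (q + 1)] is at least [6 / q] for every positive [q]. *)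
Definition loss (R : realType) (q : nat) : R := 12 * harmonic q.
(* Negative: it absorbs the polynomial factor of 2^(2q) poly(q). *)
Definition slack (R : realType) (q : nat) : R := - (120 * Num.sqrt (harmonic q)).

Lemma loss_cvg (R : realType) : loss R @ \oo --> (0 : R).
Proof.
have -> : 0 = 12 * 0 :> R by rewrite mulr0.
by apply: cvgMr; exact: cvg_harmonic.
Qed.

Lemma slack_cvg (R : realType) : slack R @ \oo --> (0 : R).
Proof.
have -> : 0 = - (120 * Num.sqrt 0) :> R by rewrite sqrtr0 mulr0 oppr0.
apply: cvgN; apply: cvgMr.
exact: (cvg_comp _ _ (@cvg_harmonic R) (@sqrt_continuous R 0)).
Qed.

Lemma le_powR2 (R : realType) (x : R) : 0 <= x -> x <= 2 `^ x.
Proof.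
move=> x0; have /andP[lo hi] := truncn_itv x0.
apply: (@le_trans _ _ (2 `^ (Num.truncn x)%:R)); last by rewrite ler_powR // ler1n.
by rewrite powR_mulrn // -natrX (le_trans (ltW hi)) // ler_nat ltn_expl.
Qed.

(** With [s] the square root of [q + 1], [q ^ 10] is at most [s ^ 20], hence at most 2 to the
    [20 * s], and 10 is at most 2 to the [4 * s]. The slack leaves room for [24 * s] in the exponent
    because [s ^ 2] is at most [2 * q]. *)
Lemma poly_slack (R : realType) q : (0 < q)%N ->
  (10 * q ^ 10 * 4 ^ q)%:R <= 2 `^ ((2 - slack R q) * q%:R) :> R.
Proof.
move=> q0; set s : R := Num.sqrt (q.+1)%:R.
have s1 : 1 <= s by rewrite -[leLHS]sqrtr1 ler_sqrt ?ltr0n // ler1n.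
have s0 : 0 < s by apply: lt_le_trans s1.
have ss : s ^+ 2 = q.+1%:R by rewrite sqr_sqrtr.
have qs : q%:R <= s ^+ 2 by rewrite ss ler_nat.
have q2 : s ^+ 2 <= 2 * q%:R by rewrite ss -natrM ler_nat mul2n -addnn -addn1 leq_add2l.
have tp (r t : R) : 2 `^ (r + t) = 2 `^ r * 2 `^ t :> R.
  by rewrite powRD // pnatr_eq0 implybT.
have expo : 2 * q%:R + 24 * s <= (2 - slack R q) * q%:R.
  rewrite /slack /= sqrtrV // -/s opprK [leRHS]mulrDl lerD2l -mulrA [s^-1 * _]mulrC.
  rewrite (@le_trans _ _ (120 * (s / 2))) //; first by move: s0; lra.
  rewrite ler_wpM2l // ler_pdivlMr // mulrAC -expr2; move: q2; lra.
apply: (@le_trans _ _ (2 `^ (2 * q%:R + 24 * s))); last by rewrite ler_powR // ler1n.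
rewrite tp -natrM powR_mulrn // -natrX expnM [leRHS]mulrC natrM ler_wpM2r //.
have -> : 24 * s = s * 20%:R + 4 * s by ring.
rewrite tp powRrM powR_mulrn ?powR_ge0 // mulrC natrM; apply: ler_pM => //; last first.
  rewrite natrX; apply: (@le_trans _ _ (s ^+ 20)); last first.
    by apply: lerXn2r; rewrite ?nnegrE ?powR_ge0 ?le_powR2 // ltW.
  by rewrite (_ : 20 = 2 * 10)%N // exprM; apply: lerXn2r; rewrite ?nnegrE // exprn_ge0 // ltW.
apply: (@le_trans _ _ (2 `^ 4%:R)); first by rewrite powR_mulrn // -natrX ler_nat.
by rewrite ler_powR ?ler1n //; move: s1; lra.
Qed.

(** This serves both parts: the same attack with [4 ^ q] times a polynomial many queries fits the
    exponent [c = 2] and a fortiori [c = 4]. *)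
Lemma attack_within (R : realType) (O : perm_oracle) n q (S : signature_scheme R O n) (c : R) :
  2 <= c ->
  ((1 < q)%N -> exists A : adversary R O n,
    (forall f r VK sg, (num_queries f (forge A r VK sg) <= 10 * q ^ 10 * 4 ^ q)%N) /\
    forall (d : measure_display) (Omega : measurableType d) (P : probability Omega R)
      (F : Omega -> perm_family O), random_perm_family P F ->
      ((1 - 6 / q%:R)%:E <= break_prob P F S A)%E) ->
  exists2 A : adversary R O n,
    adversary_queries_le A (2 `^ ((c - slack R q) * q%:R)) &
    forall (d : measure_display) (Omega : measurableType d) (P : probability Omega R)
      (F : Omega -> perm_family O), random_perm_family P F ->
      ((1 - loss R q)%:E <= break_prob P F S A)%E.
Proof.
move=> c2; have [q1 /(_ isT)[A [Aq Ab]]|q1 _] := ltnP 1 q.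
  exists A => [f r VK sg|d Omega P F randF].
    apply: (@le_trans _ _ (10 * q ^ 10 * 4 ^ q)%:R); first by rewrite ler_nat.
    apply: le_trans (poly_slack R (ltnW q1)) _.
    by rewrite ler_powR ?ler1n // ler_wpM2r // lerD2r.
  apply: le_trans (Ab _ _ _ _ randF); rewrite lee_fin lerD2l lerN2 /loss /=.
  have Q0 : 0 < q%:R :> R by rewrite ltr0n ltnW.
  rewrite ler_pdivrMr // mulrAC ler_pdivlMr ?ltr0n // -!natrM ler_nat; lia.
(* For [q] at most 1 the loss is at least 6, so any adversary will do. *)
have [A A0] := trivial_adversary R O n.
exists A => [f r VK sg|d Omega P F randF]; first by rewrite A0 powR_ge0.
apply: (@le_trans _ _ 0%E); last exact: measure_ge0.
rewrite lee_fin subr_le0 /loss /= ler_pdivlMr ?ltr0n // mul1r ler_nat.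
by apply: leq_trans (_ : 2 <= _)%N.
Qed.

Theorem theorem6p1 (R : realType) :
  (exists eps delta : nat -> R,
     [/\ eps @ \oo --> (0 : R), delta @ \oo --> (0 : R)
       & forall (m n q : nat) (S : signature_scheme R (ideal_cipher m) n),
           (q%:R <= n%:R / 4 :> R) ->
           perfectly_complete S ->
           total_queries_le S q ->
           exists2 A : adversary R (ideal_cipher m) n,
             adversary_queries_le A (2 `^ ((4 - eps q) * q%:R))
           & forall (d : measure_display) (Omega : measurableType d)
               (P : probability Omega R)
               (F : Omega -> perm_family (ideal_cipher m)),
               random_perm_family P F ->
               ((1 - delta q)%:E <= break_prob P F S A)%E])
  /\
  (exists eps delta : nat -> R,
     [/\ eps @ \oo --> (0 : R), delta @ \oo --> (0 : R)
       & forall (n q : nat) (S : signature_scheme R random_permutation n),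
           (q%:R <= n%:R / 2 :> R) ->
           perfectly_complete S ->
           total_queries_le S q ->
           exists2 A : adversary R random_permutation n,
             adversary_queries_le A (2 `^ ((2 - eps q) * q%:R))
           & forall (d : measure_display) (Omega : measurableType d)
               (P : probability Omega R)
               (F : Omega -> perm_family random_permutation),
               random_perm_family P F ->
               ((1 - delta q)%:E <= break_prob P F S A)%E]).
Proof.
split; exists (slack R), (loss R); split; try exact: slack_cvg; try exact: loss_cvg.
- move=> m n q S; rewrite ler_pdivlMr // -natrM ler_nat => qn cS tS.
  apply: attack_within => [|q1]; first by rewrite ler_nat.
  by apply: ideal_cipher_attack => //; lia.
- move=> n q S; rewrite ler_pdivlMr // -natrM ler_nat => qn cS tS.
  apply: attack_within => [//|q1].
  by apply: random_permutation_attack => //; lia.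
Qed.
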